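(* Let $D=(V,A)$ be a digraph on $n$ nodes and $k$ a positive integer. For $j=1,\dots,k$ let $\varphi_j,\gamma_j$ be integers with $0\le\varphi_j\le\gamma_j\le n-1$; let $f_{\rm in},g_{\rm in}:V\to\mathbb{Z}$ with $0\le f_{\rm in}(v)\le g_{\rm in}(v)\le k$; and let $\alpha_{\rm u}\le\beta_{\rm u}$ be integers. Let $S=\{s_1,\dots,s_k\}$ be a $k$-element set disjoint from $V$, and define $f_S(s_j)=n-\gamma_j$, $g_S(s_j)=n-\varphi_j$ $(j=1,\dots,k)$, $f_T(v)=k-g_{\rm in}(v)$, $g_T(v)=k-f_{\rm in}(v)$ $(v\in V)$, $\alpha=kn-\beta_{\rm u}$, $\beta=kn-\alpha_{\rm u}$, and the set-function $p_T$ on $V$ by $p_T(Y)=k-\varrho_D(Y)$ for $\emptyset\ne Y\subseteq V$ and $p_T(\emptyset)=0$. Then there are $k$ disjoint branchings $B_1,\dots,B_k$ in $D$ with $\varphi_j\le|B_j|\le\gamma_j$ $(j=1,\dots,k)$, with $f_{\rm in}(v)\le\varrho_F(v)\le g_{\rm in}(v)$ $(v\in V)$ and with $\alpha_{\rm u}\le|F|\le\beta_{\rm u}$, where $F=B_1\cup\cdots\cup B_k$, if and only if for every $X\subseteq S$, $Y\subseteq V$ and every subpartition $\mathcal T$ of $V-Y$ all of the following hold: (1) $\widetilde f_T(Y)-|X||Y|+\widetilde p_T(\mathcal T)-|\mathcal T||X|\le\widetilde g_S(S-X)$; (2) $\widetilde f_S(X)-|X||Y|+\widetilde p_T(\mathcal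 T)-|\mathcal T||X|\le\widetilde g_T(V-Y)$; (3) $\widetilde g_S(S-X)+\widetilde g_T(V-Y)+|X||Y|-[\widetilde p_T(\mathcal T)-|X||\mathcal T|]\ge\alpha$; (4) $\widetilde f_S(X)+\widetilde f_T(Y)-|X||Y|+\widetilde p_T(\mathcal T)-|X||\mathcal T|\le\beta$.
   Context: A branching is a spanning subgraph (identified with its arc set) that is a directed forest in which every node has in-degree at most one; disjoint means arc-disjoint; $|B|$ is the number of arcs. $\varrho_D(Y)$, $\varrho_F(Y)$ denote the number of arcs of $D$, resp. $F$, entering $Y$ (tail outside, head inside); $\varrho_F(v)=\varrho_F(\{v\})$. $\widetilde h(X)=\sum_{x\in X}h(x)$. A subpartition is a family of pairwise disjoint nonempty subsets (possibly empty); $\widetilde p_T(\mathcal T)=\sum_{W\in\mathcal T}p_T(W)$, with $\widetilde p_T(\emptyset)=0$. *)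

(* Defs.v *)
From HB Require Import structures.
From mathcomp Require Import all_boot all_order all_algebra.

Set Implicit Arguments.
Unset Strict Implicit.
Unset Printing Implicit Defensive.

(* Arcs are objects of their own, so parallel arcs (and loops) are allowed. *)
Record digraph (V A : finType) := Digraph { arc_tail : A -> V; arc_head : A -> V }.

Section Digraph.
Variables (V A : finType) (D : digraph V A).
Implicit Types (a : A) (B : {set A}) (Y : {set V}).

Definition varrho B Y : nat :=
  #|[set a in B | (arc_tail D a \notin Y) && (arc_head D a \in Y)]|.

Definition joins a u v : bool :=
  ((arc_tail D a == u) && (arc_head D a == v)) || ((arc_tail D a == v) && (arc_head D a == u)).

(* [:: (v_1, a_1); ...; (v_m, a_m)] encodes the closed undirected walk
   v_1 a_1 v_2 ... v_m a_m v_1.  Distinctness of nodes and of arcs makes a loop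
   a circuit of length 1 and two parallel or opposite arcs a circuit of
   length 2, but not a single arc traversed back and forth. *)
Definition circuit B (c : seq (V * A)) : bool :=
  [&& c != [::], uniq [seq x.1 | x <- c], uniq [seq x.2 | x <- c],
      all (fun x => x.2 \in B) c
    & cycle (fun x y => joins x.2 x.1 y.1) c].

Definition forest B : Prop := forall c : seq (V * A), ~~ circuit B c.

Definition branching B : Prop :=
  forest B /\ forall v : V, varrho B [set v] <= 1.

End Digraph.

Section SetFunctions.
Local Open Scope ring_scope.

Definition tilde (I : finType) (h : I -> int) (X : {set I}) : int :=
  \sum_(x in X) h x.

(* As the members are nonempty and pairwise disjoint, they are distinct, so a
   set of sets encodes the family. *)
Definition subpartition (V : finType) (T : {set {set V}}) (Z : {set V}) : bool :=
  [&& trivIset T, set0 \notin T & cover T \subset Z].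

End SetFunctions.

(* Main.v *)
Require Import Defs.
From HB Require Import structures.
From mathcomp Require Import all_boot all_order all_algebra.
From mathcomp Require Import zify ring.
Import Order.TTheory GRing.Theory Num.Theory.
Local Open Scope ring_scope.

(* Let R_j be the set of roots (nodes of in-degree 0) of B_j.  By Edmonds' theorem, sets R_j are
   the root sets of k disjoint branchings if and only if every nonempty Y meets at least
   p(Y) = k - rho(Y) of them, and p is intersecting supermodular.  Since |B_j| = n - |R_j| and
   rho_F(v) = k - #{j : v in R_j}, one looks for a bipartite graph (R_j) covering p whose degrees
   and number of edges lie between given bounds; (1)-(4) are obviously necessary.

   For sufficiency, a discrete sandwich theorem first yields exact degrees mS, mT within the
   bounds such that mS(X) - mT(W) <= |X| (n - |W|) - sum_{T} (p(T) - |X|) for every subpartition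
   T of W.  Next, some (R_j) with column degrees mT covers p.  Among all of these take one
   maximizing sum_j mS(j) |R_j|.  For a threshold set X = {j : mS(j) >= c} no single node can be
   moved from a row outside X to a row in X; the tight sets that block these moves form a
   subpartition showing sum_{j in X} |R_j| >= mS(X).  Finally, moves from longer to shorter rows
   are always possible, and they bring the row sizes down to mS. *)

Set Implicit Arguments.
Unset Strict Implicit.
Unset Printing Implicit Defensive.

(** Two points shape the argument. First, the bound in the cut condition contains the product of |X|
    and the number of members of T. Uncrossing two pairs (X, T) therefore needs more than a p-sum
    that does not decrease: the family produced on the union of the two ground sets must not have
    many more members than either given family. This is why [uncross] also bounds cardinalities,
    with the differences of the ground sets as slack.

    Second, only threshold sets of mS have to be checked for the row sizes. A move from a row
    outside a threshold set into a row inside it raises the weight, whatever the threshold, so one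
    weight function fills all threshold sets at once. Conversely, if the totals agree and no
    threshold set is short, a row that is too long can always be paired with a strictly shorter row
    that is too short, and a suitable move between them keeps all threshold sets from becoming
    short. *)

(** * Uncrossing subpartitions *)

Definition intersecting_supermodular (V : finType) (p : {set V} -> int) : Prop :=
  forall A B : {set V}, A :&: B != set0 -> p A + p B <= p (A :&: B) + p (A :|: B).

Section Uncrossing.
Variables (V : finType) (p : {set V} -> int).
Hypothesis p_super : intersecting_supermodular p.
Implicit Types (W Z : {set V}) (P Q : {set {set V}}).

Lemma cover1U Z P : cover (Z |: P) = Z :|: cover P.
Proof. by rewrite /cover bigcup_setU big_set1. Qed.

Lemma trivIset1U Z P : trivIset P -> [disjoint Z & cover P] -> trivIset (Z |: P).
Proof.
move=> /trivIsetP tP dZ.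
have dd A : A \in P -> [disjoint Z & A].
  by move=> AP; apply: disjointWr dZ; apply: bigcup_sup.
apply/trivIsetP=> A B /setU1P[->|AP] /setU1P[->|BP] //.
- by rewrite eqxx.
- by move=> _; apply: dd.
- by rewrite disjoint_sym => _; apply: dd.
- exact: tP.
Qed.

(** Members of [P] are absorbed into [Z] one at a time. Absorbing [A] leaves the trace on [Z] of
    every other member unchanged, because that member is disjoint from [A]. *)
Lemma merge_le P Z : trivIset P -> (forall A, A \in P -> A :&: Z != set0) ->
  p Z + \sum_(A in P) p A <= p (Z :|: cover P) + \sum_(A in P) p (A :&: Z).
Proof.
move: {2}#|P| (erefl #|P|) => c; elim: c P Z => [|c IH] P Z.
  by move/eqP; rewrite cards_eq0 => /eqP -> _ _; rewrite /cover !big_set0 setU0.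
move=> cP tP hP.
have /set0Pn[A AP] : P != set0 by rewrite -cards_eq0 cP.
have cP' : #|P :\ A| = c by have := cardsD1 A P; rewrite AP cP; lia.
have tP' : trivIset (P :\ A) by apply: trivIsetS tP; apply: subD1set.
have E B : B \in P :\ A -> B :&: (Z :|: A) = B :&: Z.
  case/setD1P=> BA BP; rewrite setIUr; have /trivIsetP/(_ _ _ BP AP BA) := tP.
  by rewrite -setI_eq0 => /eqP ->; rewrite setU0.
have hP' B : B \in P :\ A -> B :&: (Z :|: A) != set0.
  by move=> BP; rewrite E //; apply: hP; case/setD1P: BP.
have Eb : \sum_(B in P :\ A) p (B :&: (Z :|: A)) = \sum_(B in P :\ A) p (B :&: Z).
  by apply: eq_bigr => B BP; rewrite E.
have := IH _ _ cP' tP' hP'; rewrite Eb.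
have := p_super (hP A AP).
have cP1 : cover P = A :|: cover (P :\ A) by rewrite -cover1U setD1K.
rewrite !(big_setD1 A AP) /= cP1 setUA [A :|: Z]setUC.
have ar (s t a b d e f : int) : a + b <= d + e -> e + s <= f + t ->
  b + (a + s) <= f + (d + t) by clear; lia.
exact: ar.
Qed.

(* The members of T2 are merged one at a time into the family grown from T1. *)
Lemma uncross_covers (T1 T2 : {set {set V}}) :
    trivIset T1 -> set0 \notin T1 -> trivIset T2 -> set0 \notin T2 ->
  exists TU TI : {set {set V}},
   [/\ [/\ trivIset TU, set0 \notin TU & cover TU = cover T1 :|: cover T2],
       [/\ trivIset TI, set0 \notin TI & cover TI \subset cover T1 :&: cover T2],
       tilde p T1 + tilde p T2 <= tilde p TU + tilde p TI,
       (#|TU| + #|TI| = #|T1| + #|T2|)%N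
     & forall U, U \in TU ->
       ((exists2 A, A \in T1 & A \subset U) \/ (U \in T2 /\ [disjoint U & cover T1])) /\
       ((exists2 A, A \in T2 & A \subset U) \/ (U \in T1 /\ [disjoint U & cover T2]))].
Proof.
move: {2}#|T2| (erefl #|T2|) => c; elim: c T2 => [|c IH] T2.
  move/eqP; rewrite cards_eq0 => /eqP -> t1 n1 _ _; exists T1, set0.
  have c0 : cover (set0 : {set {set V}}) = set0 by rewrite /cover big_set0.
  split=> //.
  - by rewrite c0 setU0.
  - by rewrite c0 sub0set inE; split=> //; apply/trivIsetP=> A B; rewrite inE.
  - move=> U UT; split; first by left; exists U.
    by right; split=> //; rewrite c0 -setI_eq0 setI0.
move=> cT t1 n1 t2 n2.
have /set0Pn[Z ZT] : T2 != set0 by rewrite -cards_eq0 cT.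
have cT' : #|T2 :\ Z| = c by have := cardsD1 Z T2; rewrite ZT cT; lia.
have t2' : trivIset (T2 :\ Z) by apply: trivIsetS t2; apply: subD1set.
have n2' : set0 \notin T2 :\ Z by apply: contra n2 => /setD1P[].
have Z0 : Z != set0 by apply: contraNneq n2 => <-.
have dZ : [disjoint Z & cover (T2 :\ Z)].
  apply: bigcup_disjoint => A /setD1P[AZ AT].
  by have /trivIsetP/(_ _ _ ZT AT) := t2; apply; rewrite eq_sym.
have [TU [TI [[tU nU cU] [tI nI cI] ple card str]]] := IH _ cT' t1 n1 t2' n2'.
have c2 : cover T2 = Z :|: cover (T2 :\ Z) by rewrite -cover1U setD1K.
(* The members of [TU] met by [Z] are merged with [Z] into one member [U0], and their traces on [Z]
   go to the other family. These traces lie in [cover T1], since [Z] is disjoint from the rest of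
   [T2]. *)
pose H := [set A in TU | A :&: Z != set0].
have HU : H \subset TU by apply/subsetP=> A; rewrite inE => /andP[].
pose U0 := Z :|: cover H.
pose L := [set A :&: Z | A in H].
have tH := trivIsetS HU tU.
have injL : {in H &, injective (fun A => A :&: Z)}.
  move=> A B; rewrite !inE => /andP[AU /set0Pn[x xA]] /andP[BU _] eAB.
  apply/eqP; apply/negPn/negP => AB.
  have /trivIsetP/(_ _ _ AU BU AB) := tU; rewrite -setI_eq0 => /eqP/setP/(_ x).
  by move: (xA); rewrite eAB => /setIP[xB _]; case/setIP: xA => xA _; rewrite !inE xA xB.
have dRest : [disjoint U0 & cover (TU :\: H)].
  apply: bigcup_disjoint => A; rewrite !inE => /andP[AH AU].
  rewrite AU /= negbK in AH.
  rewrite -setI_eq0 setIUl setU_eq0 setIC AH /= setI_eq0 disjoint_sym.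
  apply: bigcup_disjoint => B; rewrite inE => /andP[BU BZ].
  have /trivIsetP/(_ _ _ AU BU) := tU; apply.
  by apply: contraNneq BZ => <-.
have coverUH : cover TU = cover H :|: cover (TU :\: H).
  by rewrite -{1}(setID TU H) (setIidPr HU) /cover bigcup_setU.
have LZ : cover L \subset Z :&: cover T1.
  apply/bigcupsP=> _ /imsetP[A AH ->]; apply/subsetP=> x /setIP[xA xZ].
  rewrite inE xZ /=; have: x \in cover TU by apply/bigcupP; exists A => //; apply: (subsetP HU).
  rewrite cU inE => /orP[//|x2]; move: dZ; rewrite -setI_eq0 => /eqP/setP/(_ x).
  by rewrite !inE xZ x2.
have dLI : [disjoint cover L & cover TI].
  rewrite -setI_eq0 -subset0; apply/subsetP=> x /setIP[/(subsetP LZ)/setIP[xZ _]].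
  move=> /(subsetP cI)/setIP[_ x2]; move: dZ; rewrite -setI_eq0 => /eqP/setP/(_ x).
  by rewrite !inE xZ x2.
have nL : set0 \notin L.
  by apply/imsetP=> -[A]; rewrite inE => /andP[_ A0] e; rewrite -e eqxx in A0.
have dsLI : [disjoint L & TI].
  rewrite -setI_eq0 -subset0; apply/subsetP=> A /setIP[AL AI].
  have /set0Pn[x xA] : A != set0 by apply: contraNneq nL => <-.
  move: dLI; rewrite -setI_eq0 => /eqP/setP/(_ x); rewrite !inE.
  have -> : x \in cover L by apply/bigcupP; exists A.
  by have -> : x \in cover TI by apply/bigcupP; exists A.
have tL : trivIset L.
  apply/trivIsetP=> _ _ /imsetP[A AH ->] /imsetP[B BH ->] AB.
  have AB' : A != B by apply: contraNneq AB => ->.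
  have /trivIsetP/(_ _ _ AH BH AB') := tH.
  by apply: disjointW; apply: subsetIl.
have U0n : U0 \notin TU :\: H.
  apply/negP=> UU; have /set0Pn[x xZ] := Z0.
  have x1 : x \in U0 by rewrite inE xZ.
  have x2 : x \in cover (TU :\: H) by apply/bigcupP; exists U0.
  by have /disjoint_setI0/setP/(_ x) := dRest; rewrite in_setI x1 x2 in_set0.
have U00 : U0 != set0.
  by apply: contraNneq Z0 => e; rewrite -subset0 -e subsetUl.
exists (U0 |: (TU :\: H)), (L :|: TI); split.
- split.
  + by apply: trivIset1U => //; apply: trivIsetS tU; apply: subsetDl.
  + by rewrite !inE (negPf nU) andbF orbF eq_sym.
  + by rewrite cover1U /U0 -setUA -coverUH cU c2 setUCA.
- split.
  + exact: trivIsetU.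
  + by rewrite inE negb_or nL nI.
  + rewrite /cover bigcup_setU subUset -!/(cover _); apply/andP; split.
      by apply: subset_trans LZ _; rewrite setIC; apply: setIS; rewrite c2 subsetUl.
    by apply: subset_trans cI _; apply: setIS; rewrite c2 subsetUr.
- have hH A : A \in H -> A :&: Z != set0 by rewrite inE => /andP[].
  have := merge_le tH hH.
  have := ple.
  have -> : tilde p T2 = p Z + tilde p (T2 :\ Z) by rewrite /tilde (big_setD1 Z ZT).
  have -> : tilde p (U0 |: TU :\: H) = p U0 + tilde p (TU :\: H).
    by rewrite /tilde big_setU1.
  have -> : tilde p (L :|: TI) = \sum_(A in H) p (A :&: Z) + tilde p TI.
    rewrite /tilde (eq_bigl [predU L & TI]); last by move=> A; rewrite !inE.
    by rewrite bigU //= big_imset.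
  have -> : tilde p TU = \sum_(A in H) p A + tilde p (TU :\: H).
    by rewrite /tilde (big_setID H) /= (setIidPr HU).
  rewrite -/U0.
  have ar (s t a b x y r w : int) : x + y <= s + r + w -> a + s <= b + t ->
      x + (a + y) <= b + r + (t + w) by clear; lia.
  exact: ar.
- rewrite cardsU1 U0n cardsU disjoint_setI0 // cards0 subn0.
  rewrite (card_in_imset injL) (cardsD1 Z T2) ZT.
  move: card; have := cardsID H TU; rewrite (setIidPr HU).
  move: #|H| #|TU| #|TI| #|TU :\: H| #|T1| #|T2 :\ Z|; clear; lia.
- move=> U /setU1P[->|].
    split; last by left; exists Z => //; apply: subsetUl.
    have [/eqP H0|/set0Pn[A AH]] := boolP (H == set0).
      right; have eU : U0 = Z by rewrite /U0 H0 /cover big_set0 setU0.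
      rewrite eU; split=> //.
      have: [disjoint U0 & cover TU].
        by have := dRest; rewrite H0 setD0.
      by rewrite eU; apply: disjointWr; rewrite cU subsetUl.
    left; move: (AH); rewrite inE => /andP[AU AZ].
    case: (str A AU) => -[[B B1 BA]|[A2 Ad]] _.
      exists B => //; apply: subset_trans BA _; apply: subsetU; apply/orP; right.
      by apply: bigcup_sup.
    case/negP: AZ; rewrite setI_eq0 disjoint_sym; apply: disjointWr dZ.
    exact: bigcup_sup.
  rewrite !inE => /andP[UH UU]; rewrite UU /= negbK in UH.
  have [s1 s2] := str U UU; split.
    case: s1 => [s1|[U2 Ud]]; [by left | right; split=> //].
    by case/setD1P: U2.
  case: s2 => [[A A2 AU]|[U1 Ud]].
    by left; exists A => //; case/setD1P: A2.
  right; split=> //; rewrite c2 -setI_eq0 setIUr setU_eq0 UH /=.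
  by rewrite setI_eq0.
Qed.

(** Each block is charged to a member of [T] inside it or to a point of [W] in it. Blocks are
    disjoint, so [pblock] recovers the block from its charge. *)
Lemma card_blocks (TU T : {set {set V}}) W : trivIset TU -> set0 \notin T ->
    (forall U, U \in TU -> (exists2 A, A \in T & A \subset U) \/ (exists2 x, x \in W & x \in U)) ->
  (#|TU| <= #|T| + #|W|)%N.
Proof.
move=> tU nT H.
pose f (A : {set V}) := if [pick x in A] is Some x then pblock TU x else set0.
have h := (leq_card_setU (f @: T) (pblock TU @: W)).1.
apply: leq_trans (leq_trans h (leq_add (leq_imset_card _ _) (leq_imset_card _ _))).
apply: subset_leq_card; apply/subsetP=> U UU.
rewrite inE; case: (H U UU) => [[A AT AU]|[x xW xU]]; apply/orP; [left|right]; apply/imsetP.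
  exists A => //; rewrite /f; case: pickP => [x xA|A0].
    by rewrite (def_pblock tU UU) //; apply: (subsetP AU).
  case/negP: nT; suff <- : A = set0 by [].
  by apply/setP=> x; rewrite inE; apply: A0.
by exists x => //; rewrite (def_pblock tU UU).
Qed.

(* Members of T1 inside W2 that miss T2 (and vice versa) go to TI; this is what makes the
   two bounds on #|TU| hold. *)
Lemma uncross (W1 W2 : {set V}) (T1 T2 : {set {set V}}) :
    subpartition T1 W1 -> subpartition T2 W2 ->
  exists TU TI : {set {set V}},
   [/\ subpartition TU (W1 :|: W2), subpartition TI (W1 :&: W2),
       tilde p T1 + tilde p T2 <= tilde p TU + tilde p TI,
       (#|TU| + #|TI| = #|T1| + #|T2|)%N
     & (#|TU| <= #|T1| + #|W2 :\: W1|)%N /\ (#|TU| <= #|T2| + #|W1 :\: W2|)%N].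
Proof.
case/and3P=> t1 n1 c1 /and3P[t2 n2 c2].
pose D1 := [set A in T1 | [disjoint A & cover T2] && (A \subset W2)].
pose D2 := [set A in T2 | [disjoint A & cover T1] && (A \subset W1)].
have D1T : D1 \subset T1 by apply/subsetP=> A; rewrite inE => /andP[].
have D2T : D2 \subset T2 by apply/subsetP=> A; rewrite inE => /andP[].
have t1' : trivIset (T1 :\: D1) by apply: trivIsetS t1; apply: subsetDl.
have t2' : trivIset (T2 :\: D2) by apply: trivIsetS t2; apply: subsetDl.
have n1' : set0 \notin T1 :\: D1 by rewrite inE (negPf n1) andbF.
have n2' : set0 \notin T2 :\: D2 by rewrite inE (negPf n2) andbF.
have sc1 : cover (T1 :\: D1) \subset cover T1.
  by apply/bigcupsP=> A /setDP[AT _]; apply: bigcup_sup.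
have sc2 : cover (T2 :\: D2) \subset cover T2.
  by apply/bigcupsP=> A /setDP[AT _]; apply: bigcup_sup.
have [TU [TI [[tU nU cU] [tI nI cI] ple card str]]] := uncross_covers t1' n1' t2' n2'.
have cD1 : cover D1 \subset cover T1 by apply/bigcupsP=> A /(subsetP D1T) AT; apply: bigcup_sup.
have cD2 : cover D2 \subset cover T2 by apply/bigcupsP=> A /(subsetP D2T) AT; apply: bigcup_sup.
have dD1 : [disjoint cover D1 & cover T2].
  by rewrite disjoint_sym; apply: bigcup_disjoint => A; rewrite inE disjoint_sym => /and3P[].
have dD2 : [disjoint cover D2 & cover T1].
  by rewrite disjoint_sym; apply: bigcup_disjoint => A; rewrite inE disjoint_sym => /and3P[].
have cI1 := subset_trans cI (subset_trans (subsetIl _ _) sc1).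
have cI2 := subset_trans cI (subset_trans (subsetIr _ _) sc2).
have dset P Q : set0 \notin P -> [disjoint cover P & cover Q] -> [disjoint P & Q].
  move=> nP dPQ; rewrite -setI_eq0 -subset0; apply/subsetP=> A /setIP[AL AI].
  have /set0Pn[x xA] : A != set0 by apply: contraNneq nP => <-.
  move: dPQ; rewrite -setI_eq0 => /eqP/setP/(_ x); rewrite !inE.
  have -> : x \in cover P by apply/bigcupP; exists A.
  by have -> : x \in cover Q by apply/bigcupP; exists A.
have nD1 : set0 \notin D1 by apply: contra n1 => /(subsetP D1T).
have nD2 : set0 \notin D2 by apply: contra n2 => /(subsetP D2T).
have d12 : [disjoint cover D1 & cover D2] by apply: disjointWr cD2 dD1.
have d12I : [disjoint cover (D1 :|: D2) & cover TI].
  rewrite /cover bigcup_setU -!/(cover _) -setI_eq0 setIUl setU_eq0 !setI_eq0.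
  by apply/andP; split; [apply: disjointWr cI2 dD1 | apply: disjointWr cI1 dD2].
have tsumU P Q : [disjoint P & Q] -> tilde p (P :|: Q) = tilde p P + tilde p Q.
  move=> dPQ; rewrite /tilde (eq_bigl [predU P & Q]); last by move=> A; rewrite !inE.
  by rewrite bigU.
have cardU (P Q : {set {set V}}) : [disjoint P & Q] -> #|P :|: Q| = (#|P| + #|Q|)%N.
  by move=> dPQ; rewrite cardsU disjoint_setI0 // cards0 subn0.
have dd12 := dset _ _ nD1 d12.
have n12 : set0 \notin D1 :|: D2 by rewrite inE negb_or nD1 nD2.
have dd12I := dset _ _ n12 d12I.
have t12 : trivIset (D1 :|: D2).
  by apply: trivIsetU => //; [apply: trivIsetS D1T t1 | apply: trivIsetS D2T t2].
have split1 : tilde p T1 = tilde p D1 + tilde p (T1 :\: D1).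
  by rewrite /tilde (big_setID D1) /= (setIidPr D1T).
have split2 : tilde p T2 = tilde p D2 + tilde p (T2 :\: D2).
  by rewrite /tilde (big_setID D2) /= (setIidPr D2T).
have csplit1 : #|T1| = (#|D1| + #|T1 :\: D1|)%N by rewrite -(cardsID D1) (setIidPr D1T).
have csplit2 : #|T2| = (#|D2| + #|T2 :\: D2|)%N by rewrite -(cardsID D2) (setIidPr D2T).
exists TU, (D1 :|: D2 :|: TI); split.
- apply/and3P; split=> //; rewrite cU; apply: setUSS.
    exact: subset_trans sc1 c1.
  exact: subset_trans sc2 c2.
- apply/and3P; split.
  + exact: trivIsetU.
  + by rewrite inE negb_or n12 nI.
  + rewrite /cover !bigcup_setU -!/(cover _) !subUset -andbA; apply/and3P; split.
    * rewrite subsetI (subset_trans cD1 c1); apply/bigcupsP=> A.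
      by rewrite inE => /and3P[].
    * rewrite subsetI (subset_trans cD2 c2) andbT; apply/bigcupsP=> A.
      by rewrite inE => /and3P[].
    * by rewrite subsetI (subset_trans cI1 c1) (subset_trans cI2 c2).
- have ar (a b c d x y : int) : c + d <= x + y -> a + c + (b + d) <= x + (a + b + y).
    by clear; lia.
  by rewrite split1 split2 !tsumU //; apply: ar.
- by rewrite csplit1 csplit2 !cardU // addnCA card addnACA.
- have out (A W : {set V}) : ~~ (A \subset W) -> exists2 x, x \in A & x \notin W.
    by move/subsetPn.
  split.
    (* A block containing no member of [T1 :\: D1] is a member of [T2] outside [D2]. It misses
       [cover T1], since [D1] avoids [T2]; so it failed to enter [D2] only by having a point outside
       [W1]. *)
    rewrite csplit1; rewrite -addnA; apply: leq_trans (leq_addl _ _).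
    apply: card_blocks => // U UU.
    have [[s|[U2 Ud]] _] := str U UU; [by left|right].
    move: U2; rewrite !inE => /andP[]; rewrite negb_and => /orP[UD U2|]; first by rewrite U2 in UD.
    rewrite negb_and => /orP[/negP ndis U2|/out[x xU xW] U2]; last first.
      exists x => //; rewrite inE xW; apply: (subsetP c2); apply/bigcupP; by exists U.
    case: ndis; apply: bigcup_disjoint => A A1.
    have [AD|AD] := boolP (A \in D1); last first.
      apply: disjointWr Ud; apply: bigcup_sup; by rewrite inE AD.
    rewrite disjoint_sym; apply: disjointW dD1; apply: bigcup_sup => //.
  rewrite csplit2; rewrite -addnA; apply: leq_trans (leq_addl _ _).
  apply: card_blocks => // U UU.
  have [_ [s|[U2 Ud]]] := str U UU; [by left|right].
  move: U2; rewrite !inE => /andP[]; rewrite negb_and => /orP[UD U2|]; first by rewrite U2 in UD.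
  rewrite negb_and => /orP[/negP ndis U2|/out[x xU xW] U2]; last first.
    exists x => //; rewrite inE xW; apply: (subsetP c1); apply/bigcupP; by exists U.
  case: ndis; apply: bigcup_disjoint => A A1.
  have [AD|AD] := boolP (A \in D2); last first.
    apply: disjointWr Ud; apply: bigcup_sup; by rewrite inE AD.
  rewrite disjoint_sym; apply: disjointW dD2; apply: bigcup_sup => //.
Qed.

End Uncrossing.

(** * The discrete sandwich theorem *)

Definition supermodular (E : finType) (p : {set E} -> int) : Prop :=
  forall A B : {set E}, p A + p B <= p (A :&: B) + p (A :|: B).

Section Sandwich.
Variable E : finType.
Implicit Types (p q : {set E} -> int) (A B U : {set E}).

(** Relative to [U], because the sandwich theorem is proved by removing elements of the ground
    set. *)
Definition supermodular_on U p : Prop :=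
  forall A B, A \subset U -> B \subset U -> p A + p B <= p (A :&: B) + p (A :|: B).

Lemma setU1IK e A B : e \notin B -> (e |: A) :&: B = A :&: B.
Proof.
by move=> eB; rewrite setIUl; have /disjoint_setI0 -> : [disjoint [set e] & B];
  rewrite ?set0U // disjoints1.
Qed.

(** Once [m e = c] is fixed, the lower bounds for [A] and [e |: A] both bound [m] on [A]; the
    maximum combines them. Supermodularity is checked for each choice of the two alternatives, hence
    the four instances. *)
Lemma supermodular_on_contract U e p (c : int) : e \in U -> supermodular_on U p ->
  supermodular_on (U :\ e) (fun A => Num.max (p A) (p (e |: A) - c)).
Proof.
move=> eU hp A B AU BU /=.
have [sA sB] := (subset_trans AU (subD1set _ _), subset_trans BU (subD1set _ _)).
have seA : e |: A \subset U by rewrite subUset sub1set eU.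
have seB : e |: B \subset U by rewrite subUset sub1set eU.
have neA : e \notin A by apply/negP=> /(subsetP AU); rewrite !inE eqxx.
have neB : e \notin B by apply/negP=> /(subsetP BU); rewrite !inE eqxx.
have h1 := hp _ _ sA sB.
have h2 := hp _ _ sA seB; rewrite setUCA setIC setU1IK // setIC in h2.
have h3 := hp _ _ seA sB; rewrite -setUA setU1IK // in h3.
have h4 := hp _ _ seA seB; rewrite setUACA setUid -setUIr in h4.
clear -h1 h2 h3 h4; lia.
Qed.

(* The value of m at e is chosen first; the bounds max (p (e |: A) + q A) and
   min (- p A - q (e |: A)) it has to respect are compatible by uncrossing. *)
Lemma discrete_sandwich_on U p q : supermodular_on U p -> supermodular_on U q ->
    p set0 = 0 -> q set0 = 0 -> (forall A, A \subset U -> p A + q A <= 0) ->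
  exists m : E -> int, forall A, A \subset U -> p A <= tilde m A /\ tilde m A <= - q A.
Proof.
move: {2}#|U| (erefl #|U|) => n; elim: n U p q => [|n IH] U p q cU hp hq p0 q0 pq.
  exists (fun=> 0) => A; move/eqP: cU; rewrite cards_eq0 => /eqP ->.
  by rewrite subset0 => /eqP ->; rewrite /tilde big_set0 p0 q0.
have /set0Pn[e eU] : U != set0 by rewrite -cards_eq0 cU.
have cU' : #|U :\ e| = n by have := cardsD1 e U; rewrite eU cU; lia.
have sU' A : A \subset U :\ e -> A \subset U by move/subset_trans; apply; apply: subD1set.
have sUe A : A \subset U :\ e -> e |: A \subset U.
  by move=> /sU' AU; rewrite subUset AU sub1set eU.
have neA A : A \subset U :\ e -> e \notin A.
  by move=> AU; apply/negP=> /(subsetP AU); rewrite !inE eqxx.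
have compat A B : A \subset U :\ e -> B \subset U :\ e ->
    p (e |: A) + q A <= - p B - q (e |: B).
  move=> AU BU.
  have h1 := hp _ _ (sUe _ AU) (sU' _ BU); rewrite -setUA setU1IK ?neA // in h1.
  have h2 := hq _ _ (sU' _ AU) (sUe _ BU); rewrite setUCA setIC setU1IK ?neA // setIC in h2.
  have h3 : p (A :&: B) + q (A :&: B) <= 0.
    by apply: pq; apply: subset_trans (subsetIl _ _) (sU' _ AU).
  have h4 : p (e |: (A :|: B)) + q (e |: (A :|: B)) <= 0.
    by apply: pq; apply: sUe; rewrite subUset AU.
  by clear -h1 h2 h3 h4; lia.
have [c [c1 c2]] : exists c : int, (forall A, A \subset U :\ e -> p (e |: A) + q A <= c) /\
    (forall B, B \subset U :\ e -> c <= - p B - q (e |: B)).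
  have s0 : set0 \subset U :\ e by apply: sub0set.
  pose A0 := [arg max_(A > set0 | A \subset U :\ e) (p (e |: A) + q A)]%O.
  exists (p (e |: A0) + q A0); rewrite /A0; case: Order.TotalTheory.arg_maxP => // A1 A1U A1max.
  by split=> [A AU|B BU]; [apply: A1max | apply: compat].
(* The upper bound says that [q] is a lower bound for [- m], whose value at [e] is [- c]. *)
have [|||m mP] := IH _ _ _ cU' (supermodular_on_contract c eU hp)
                                (supermodular_on_contract (- c) eU hq).
- by have /= := c1 set0 (sub0set _); clear -p0 q0; lia.
- by have /= := c2 set0 (sub0set _); clear -p0 q0; lia.
- move=> A AU /=; have := pq _ (sU' _ AU); have := pq _ (sUe _ AU).
  by have := c1 _ AU; have := c2 _ AU; clear; lia.
exists (fun x => if x == e then c else m x) => A AU.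
have tm B : e \notin B -> tilde (fun x => if x == e then c else m x) B = tilde m B.
  by move=> eB; apply: eq_bigr => x xB; case: eqP => // xe; rewrite -xe xB in eB.
have [eA|eA] := boolP (e \in A).
  have AU' : A :\ e \subset U :\ e by apply: setSD.
  have := mP _ AU'; rewrite /= setD1K //.
  have -> : tilde (fun x => if x == e then c else m x) A = c + tilde m (A :\ e).
    by rewrite -(tm (A :\ e)) ?inE ?eqxx // /tilde (big_setD1 e eA) /= eqxx.
  by clear; lia.
have AU' : A \subset U :\ e by rewrite subsetD1 AU.
by rewrite tm //; have /= := mP _ AU'; clear; lia.
Qed.

(* With q = - b this is Frank's sandwich theorem for p <= b, p supermodular, b submodular. *)
Lemma discrete_sandwich p q : supermodular p -> supermodular q ->
    p set0 = 0 -> q set0 = 0 -> (forall A, p A + q A <= 0) ->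
  exists m : E -> int, forall A, p A <= tilde m A /\ tilde m A <= - q A.
Proof.
move=> hp hq p0 q0 pq.
have [m mP] := discrete_sandwich_on (fun A B _ _ => hp A B) (fun A B _ _ => hq A B) p0 q0
  (fun A (_ : A \subset setT) => pq A).
by exists m => A; apply: mP; apply: subsetT.
Qed.
End Sandwich.

(** * Degree vectors *)

Lemma tilde_setID (E : finType) (h : E -> int) (A B : {set E}) :
  tilde h A = tilde h (A :&: B) + tilde h (A :\: B).
Proof. by rewrite /tilde (big_setID B). Qed.

Lemma tildeUI (E : finType) (h : E -> int) (A B : {set E}) :
  tilde h A + tilde h B = tilde h (A :&: B) + tilde h (A :|: B).
Proof.
have -> : tilde h A = tilde h (A :&: B) + tilde h (A :\: B) by rewrite /tilde (big_setID B).
have -> : tilde h (A :|: B) = tilde h B + tilde h (A :\: B).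
  by rewrite /tilde (big_setID B) /= (setIidPr (subsetUr _ _)) setDUl setDv setU0.
by rewrite -addrA [tilde h (A :\: B) + _]addrC.
Qed.

Lemma le_tilde (E : finType) (h1 h2 : E -> int) (A : {set E}) :
  (forall x, h1 x <= h2 x) -> tilde h1 A <= tilde h2 A.
Proof. by move=> h; apply: ler_sum. Qed.

Lemma tilde0 (E : finType) (h : E -> int) : tilde h set0 = 0.
Proof. by rewrite /tilde big_set0. Qed.

Lemma tildeC (E : finType) (h : E -> int) (A : {set E}) :
  tilde h setT = tilde h A + tilde h (~: A).
Proof. by rewrite -[RHS]addr0 -(tilde0 h) tildeUI setICr setUCr tilde0 add0r addr0. Qed.

(** For [c = tilde u setT] this is the lower border function of the vectors x with l <= x <= u and
    total 0: x(A) is at least l(A), and also minus x of the complement of A, hence at least u(A) -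
    u(E). *)
Lemma max_box_supermodular (E : finType) (l u : E -> int) (c : int) :
    (forall x, l x <= u x) ->
  supermodular (fun A : {set E} => Num.max (tilde l A) (tilde u A - c)).
Proof.
move=> lu A B /=.
have h1 := tildeUI l A B; have h2 := tildeUI u A B.
have cross C D : tilde l C + tilde u D <= tilde l (C :&: D) + tilde u (C :|: D).
  have eC : tilde l C = tilde l (C :&: D) + tilde l (C :\: D) by rewrite /tilde (big_setID D).
  have eD : tilde u (C :|: D) = tilde u D + tilde u (C :\: D).
    by rewrite /tilde (big_setID D) /= (setIidPr (subsetUr _ _)) setDUl setDv setU0.
  have := @le_tilde _ l u (C :\: D) lu; rewrite eC eD; clear; lia.
have h3 := cross A B; have h4 := cross B A; rewrite [B :&: A]setIC [B :|: A]setUC in h4.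
clear -h1 h2 h3 h4; lia.
Qed.

Section DegreeVectors.
Variables (I V : finType) (p : {set V} -> int).
Hypothesis p_super : intersecting_supermodular p.
Implicit Types (X : {set I}) (W : {set V}) (T : {set {set V}}).

(** In a family covering [p] with degrees mS, mT, the rows of [X] have at most |X| |~: W| entries
    outside W, and the other rows have at least p(T) - |X| |T| entries in W. Counting the entries in
    X and W twice gives mS(X) + excess <= mT(W). *)
Definition excess X W T : int :=
  tilde p T - #|X|%:Z * #|T|%:Z - #|X|%:Z * #|~: W|%:Z.

Definition max_excess X W : int :=
  excess X W [arg max_(T > set0 | subpartition T W) excess X W T]%O.

Lemma subpartition0 W : subpartition set0 W.
Proof.
apply/and3P; split; last by rewrite /cover big_set0 sub0set.
  by apply/trivIsetP=> A B; rewrite inE.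
by rewrite inE.
Qed.

Lemma max_excess_ub X W T : subpartition T W -> excess X W T <= max_excess X W.
Proof.
move=> TW; rewrite /max_excess; case: Order.TotalTheory.arg_maxP => [|T' _]; last exact.
exact: subpartition0.
Qed.

Lemma max_excess_attained X W : exists2 T, subpartition T W & max_excess X W = excess X W T.
Proof.
rewrite /max_excess; case: Order.TotalTheory.arg_maxP => [|T TW _]; last by exists T.
exact: subpartition0.
Qed.

(** Write |X1| = x + a, |X2| = x + b, with x the size of the intersection. In the terms |X| (|T| +
    |~: W|) the coefficient of x cancels, since the numbers of members and the sizes of complements
    add up; those of a and b have the right sign by the two bounds on #|TU|. *)
Lemma max_excess_supermodular X1 X2 W1 W2 :
  max_excess X1 W1 + max_excess X2 W2 <=
  max_excess (X1 :&: X2) (W1 :&: W2) + max_excess (X1 :|: X2) (W1 :|: W2).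
Proof.
have [T1 T1W ->] := max_excess_attained X1 W1.
have [T2 T2W ->] := max_excess_attained X2 W2.
have [TU [TI [sU sI ple card [cU1 cU2]]]] := uncross p_super T1W T2W.
apply: le_trans (lerD (max_excess_ub _ sI) (max_excess_ub _ sU)).
rewrite /excess.
have x1 := cardsID X2 X1; have x2 := cardsID X1 X2.
have xu := cardsUI X1 X2; have wu := cardsUI (~: W1) (~: W2).
rewrite -setCI -setCU in wu.
have w1 := cardsID (~: W1) (~: (W1 :&: W2)).
have w2 := cardsID (~: W2) (~: (W1 :&: W2)).
have e1 : ~: (W1 :&: W2) :&: ~: W1 = ~: W1 by apply/setIidPr; rewrite setCS subsetIl.
have e2 : ~: (W1 :&: W2) :&: ~: W2 = ~: W2.
  by apply/setIidPr; rewrite setCS subsetIr.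
have e3 : ~: (W1 :&: W2) :\: ~: W1 = W1 :\: W2.
  by apply/setP=> x; rewrite !inE; case: (x \in W1); case: (x \in W2).
have e4 : ~: (W1 :&: W2) :\: ~: W2 = W2 :\: W1.
  by apply/setP=> x; rewrite !inE; case: (x \in W1); case: (x \in W2).
rewrite e1 e3 in w1; rewrite e2 e4 in w2; rewrite [X2 :&: X1]setIC in x2.
move: (tilde p T1) (tilde p T2) (tilde p TU) (tilde p TI) ple => P1 P2 PU PI ple.
move: #|X1| #|X2| #|X1 :&: X2| #|X1 :|: X2| #|X1 :\: X2| #|X2 :\: X1| x1 x2 xu
  => x1 x2 xi xu a b ex1 ex2 exu.
move: #|~: W1| #|~: W2| #|~: (W1 :&: W2)| #|~: (W1 :|: W2)| #|W1 :\: W2| #|W2 :\: W1|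
  wu w1 w2 cU1 cU2
  => c1 c2 ci cu d1 d2 ewu ew1 ew2.
move: #|T1| #|T2| #|TU| #|TI| card => q1 q2 qU qI card le1 le2.
have {}ex1 : x1 = (xi + a)%N by lia.
have {}ex2 : x2 = (xi + b)%N by lia.
have {}exu : xu = (xi + a + b)%N by lia.
have hA : 0 <= a%:Z * (q1%:Z + c1%:Z - qU%:Z - cu%:Z) by apply: mulr_ge0; lia.
have hB : 0 <= b%:Z * (q2%:Z + c2%:Z - qU%:Z - cu%:Z) by apply: mulr_ge0; lia.
have hX : xi%:Z * (q1%:Z + q2%:Z + c1%:Z + c2%:Z - qU%:Z - cu%:Z - qI%:Z - ci%:Z) = 0.
  by apply/eqP; rewrite mulf_eq0; apply/orP; right; apply/eqP; lia.
subst x1 x2 xu; clear -ple hA hB hX; rewrite !PoszD; nia.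
Qed.

Notation E := (option (I + V)).
Definition row_part (Z : {set E}) : {set I} := [set j | Some (inl j) \in Z].
Definition col_part (Z : {set E}) : {set V} := [set v | Some (inr v) \in Z].

Lemma tilde_option (h : E -> int) (Z : {set E}) :
  tilde h Z = tilde (fun j => h (Some (inl j))) (row_part Z)
    + tilde (fun v => h (Some (inr v))) (col_part Z)
    + (if None \in Z then h None else 0).
Proof.
rewrite /tilde [LHS]big_mkcond (bigD1 None) //= addrC; congr (_ + _).
rewrite (reindex_omap Some id) => [|[x|] //].
rewrite (eq_bigl predT) => [|x]; last by rewrite /= eqxx.
by rewrite big_sumType /= -!big_mkcond; congr (_ + _); apply: eq_bigl => x; rewrite inE.
Qed.

(* The vectors (mS, - mT) of total 0 satisfying the last condition form a base polyhedron with
   border function - max_excess.  The bounds are encoded by P on the ground set I + V + {None}: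
   P is the sum of the lower border functions of the base polyhedra of total 0 on I + {None} with
   fS <= x <= gS and - beta <= x(None) <= - alpha, and on V + {None} with - gT <= x <= - fT and
   alpha <= x(None) <= beta. *)
Lemma degree_vectors (fS gS : I -> int) (fT gT : V -> int) (alpha beta : int) :
    (forall j, fS j <= gS j) -> (forall v, fT v <= gT v) -> alpha <= beta ->
    (forall X W T, subpartition T W ->
      [/\ tilde fT (~: W) + excess X W T <= tilde gS (~: X),
          tilde fS X + excess X W T <= tilde gT W,
          alpha <= tilde gS (~: X) + tilde gT W - excess X W T
        & tilde fS X + tilde fT (~: W) + excess X W T <= beta]) ->
  exists (mS : I -> int) (mT : V -> int),
    [/\ forall j, fS j <= mS j <= gS j, forall v, fT v <= mT v <= gT v,
        tilde mS setT = tilde mT setT, alpha <= tilde mS setT <= beta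
      & forall X W T, subpartition T W -> tilde mS X + excess X W T <= tilde mT W].
Proof.
move=> fgS fgT ab cond.
pose lS (e : E) : int := match e with Some (inl j) => fS j | Some (inr _) => 0 | None => - beta end.
pose uS (e : E) : int := match e with Some (inl j) => gS j | Some (inr _) => 0 | None => - alpha end.
pose lT (e : E) : int := match e with Some (inr v) => - gT v | Some (inl _) => 0 | None => alpha end.
pose uT (e : E) : int := match e with Some (inr v) => - fT v | Some (inl _) => 0 | None => beta end.
have luS e : lS e <= uS e by case: e => [[j|v]|] //=; rewrite lerN2.
have luT e : lT e <= uT e by case: e => [[j|v]|] //=; rewrite lerN2.
pose P (Z : {set E}) : int := Num.max (tilde lS Z) (tilde uS Z - tilde uS setT)
                        + Num.max (tilde lT Z) (tilde uT Z - tilde uT setT).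
pose Q (Z : {set E}) : int := max_excess (row_part Z) (col_part Z).
have rowT : row_part setT = setT by apply/setP=> j; rewrite !inE.
have colT : col_part setT = setT by apply/setP=> j; rewrite !inE.
have row0 : row_part set0 = set0 by apply/setP=> j; rewrite !inE.
have col0 : col_part set0 = set0 by apply/setP=> j; rewrite !inE.
have tz (J : finType) (A : {set J}) : tilde (fun=> 0) A = 0 by rewrite /tilde big1.
have tN (J : finType) (h : J -> int) (A : {set J}) : tilde (fun x => - h x) A = - tilde h A.
  by rewrite /tilde sumrN.
have elS Z : tilde lS Z = tilde fS (row_part Z) + (if None \in Z then - beta else 0).
  by rewrite tilde_option /= tz addr0.
have euS Z : tilde uS Z = tilde gS (row_part Z) + (if None \in Z then - alpha else 0).
  by rewrite tilde_option /= tz addr0.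
have elT Z : tilde lT Z = - tilde gT (col_part Z) + (if None \in Z then alpha else 0).
  by rewrite tilde_option /= tz add0r tN.
have euT Z : tilde uT Z = - tilde fT (col_part Z) + (if None \in Z then beta else 0).
  by rewrite tilde_option /= tz add0r tN.
have euS1 : tilde uS setT = tilde gS setT - alpha by rewrite euS rowT inE.
have euT1 : tilde uT setT = - tilde fT setT + beta by rewrite euT colT inE.
have exc0 X W : excess X W set0 = - (#|X|%:Z * #|~: W|%:Z).
  by rewrite /excess tilde0 cards0 mulr0 subr0 sub0r.
have [_ _ c3 _] := cond set0 set0 set0 (subpartition0 _).
have [_ _ c3' _] := cond setT setT set0 (subpartition0 _).
have [_ _ _ c4] := cond setT setT set0 (subpartition0 _).
have [_ _ _ c4'] := cond set0 set0 set0 (subpartition0 _).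
rewrite exc0 cards0 mul0r oppr0 subr0 setC0 tilde0 addr0 in c3.
rewrite exc0 !setCT cards0 mulr0 oppr0 subr0 tilde0 add0r in c3'.
rewrite exc0 !setCT cards0 mulr0 oppr0 tilde0 !addr0 in c4.
rewrite exc0 cards0 mul0r oppr0 setC0 tilde0 add0r addr0 in c4'.
have supP : supermodular P.
  move=> A B; rewrite /P addrACA [leRHS]addrACA.
  exact: lerD (max_box_supermodular _ luS A B) (max_box_supermodular _ luT A B).
have supQ : supermodular Q.
  move=> A B.
  have rI : row_part (A :&: B) = row_part A :&: row_part B by apply/setP=> x; rewrite !inE.
  have cI : col_part (A :&: B) = col_part A :&: col_part B by apply/setP=> x; rewrite !inE.
  have rU : row_part (A :|: B) = row_part A :|: row_part B by apply/setP=> x; rewrite !inE.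
  have cU : col_part (A :|: B) = col_part A :|: col_part B by apply/setP=> x; rewrite !inE.
  by rewrite /Q rI cI rU cU; apply: max_excess_supermodular.
have P0 : P set0 = 0.
  rewrite /P !tilde0 euS1 euT1; clear -c3 c4'; lia.
have Q0 : Q set0 = 0.
  rewrite /Q row0 col0; have [T TW ->] := max_excess_attained set0 set0.
  rewrite /excess cards0 !mul0r !subr0.
  suff -> : T = set0 by rewrite tilde0.
  apply/setP=> A; rewrite inE; apply/negP=> AT; case/and3P: TW => _ n0 c0.
  case/negP: n0; suff <- : A = set0 by [].
  have AC : A \subset cover T by apply: bigcup_sup.
  by apply/eqP; rewrite -subset0; apply: subset_trans AC c0.
(* Each choice of branches in the two maxima yields one of the four conditions. The first one
   appears weakened by [alpha - beta] when [None] is not in [Z], the second one when it is. *)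
have PQ Z : P Z + Q Z <= 0.
  rewrite /P /Q; set X := row_part Z; set W := col_part Z.
  have [T TW ->] := max_excess_attained X W.
  have [d1 d2 d3 d4] := cond X W T TW.
  have k1 := tildeC gS X; have k2 := tildeC fT W.
  rewrite euS1 euT1 elS elT euS euT -/X -/W.
  move: (excess X W T) d1 d2 d3 d4 => ex; rewrite k1 k2.
  by case: ifP => _; clear -ab; lia.
have [m mP] := discrete_sandwich supP supQ P0 Q0 PQ.
pose mS j : int := m (Some (inl j)); pose mT v : int := - m (Some (inr v)).
have em Z : tilde m Z = tilde mS (row_part Z) - tilde mT (col_part Z)
                         + (if None \in Z then m None else 0).
  rewrite tilde_option /mT; congr (_ + _ + _).
  by rewrite tN opprK.
have QT : 0 <= Q setT.
  rewrite /Q rowT colT; apply: le_trans (max_excess_ub setT (subpartition0 setT)).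
  by rewrite exc0 setCT cards0 mulr0 oppr0.
have PT : 0 <= P setT by rewrite /P !subrr; clear; lia.
have QN : 0 <= Q [set None].
  have rN : row_part [set None] = set0 by apply/setP=> x; rewrite !inE.
  have cN : col_part [set None] = set0 by apply/setP=> x; rewrite !inE.
  by rewrite /Q rN cN -row0 -col0 -/(Q set0) Q0.
have QC : 0 <= Q (~: [set None]).
  have rN : row_part (~: [set None]) = setT by apply/setP=> x; rewrite !inE.
  have cN : col_part (~: [set None]) = setT by apply/setP=> x; rewrite !inE.
  by rewrite /Q rN cN -{1}rowT -colT.
(* [m] is nonnegative on the whole ground set and nonpositive on [[set None]] and on its complement,
   so all three values vanish. *)
have mN : m None = 0 /\ tilde mS setT = tilde mT setT.
  have [a1 a2] := mP setT; have [_ b2] := mP [set None]; have [_ d2] := mP (~: [set None]).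
  have eq2 := tildeC m [set None].
  have e1 : tilde m [set None] = m None by rewrite /tilde big_set1.
  have eq3 := em setT; rewrite rowT colT inE /= in eq3.
  have ar (a b c d e f g h k l : int) : 0 <= a -> 0 <= b -> 0 <= c -> 0 <= d -> a <= e -> e <= - b ->
      f <= - c -> g <= - d -> e = f + g -> f = h -> e = k - l + h -> h = 0 /\ k = l.
    by clear; split; lia.
  exact: (ar _ _ _ _ _ _ _ _ _ _ PT QT QN QC a1 a2 b2 d2 eq2 e1 eq3).
case: mN => mN mST.
have {}em Z : tilde m Z = tilde mS (row_part Z) - tilde mT (col_part Z).
  by rewrite em mN if_same addr0.
have lo Z : P Z <= tilde mS (row_part Z) - tilde mT (col_part Z) by rewrite -em; case: (mP Z).
have t1 (J : finType) (h : J -> int) x : tilde h [set x] = h x by rewrite /tilde big_set1.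
exists mS, mT; split=> //.
- move=> j; apply/andP; split.
    have := lo [set Some (inl j)].
    have -> : row_part [set Some (inl j)] = [set j] by apply/setP=> x; rewrite !inE.
    have -> : col_part [set Some (inl j)] = set0 by apply/setP=> x; rewrite !inE.
    by rewrite tilde0 subr0 /P !t1 /=; clear; lia.
  have := lo (~: [set Some (inl j)]).
  have -> : row_part (~: [set Some (inl j)]) = ~: [set j] by apply/setP=> x; rewrite !inE.
  have -> : col_part (~: [set Some (inl j)]) = setT by apply/setP=> x; rewrite !inE.
  have := tildeC mS [set j]; have := tildeC uS [set Some (inl j)].
  have := tildeC uT [set Some (inl j)]; rewrite mST !t1 /P /=.
  by clear; lia.
- move=> v; apply/andP; split.
    have := lo (~: [set Some (inr v)]).
    have -> : row_part (~: [set Some (inr v)]) = setT by apply/setP=> x; rewrite !inE.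
    have -> : col_part (~: [set Some (inr v)]) = ~: [set v] by apply/setP=> x; rewrite !inE.
    have := tildeC mT [set v]; have := tildeC uS [set Some (inr v)].
    have := tildeC uT [set Some (inr v)]; rewrite mST !t1 /P /=.
    by clear; lia.
  have := lo [set Some (inr v)].
  have -> : row_part [set Some (inr v)] = set0 by apply/setP=> x; rewrite !inE.
  have -> : col_part [set Some (inr v)] = [set v] by apply/setP=> x; rewrite !inE.
  by rewrite tilde0 sub0r /P !t1 /=; clear; lia.
(* The bounds on the total come from the second branch of one maximum: [P ZS >= alpha] and
   [P ZT >= - beta]. *)
- pose ZS : {set E} := [set e | if e is Some (inl _) then true else false].
  pose ZT : {set E} := [set e | if e is Some (inr _) then true else false].
  have rS : row_part ZS = setT by apply/setP=> x; rewrite !inE.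
  have cS : col_part ZS = set0 by apply/setP=> x; rewrite !inE.
  have rT : row_part ZT = set0 by apply/setP=> x; rewrite !inE.
  have cT : col_part ZT = setT by apply/setP=> x; rewrite !inE.
  have nS : None \in ZS = false by rewrite inE.
  have nT : None \in ZT = false by rewrite inE.
  have := lo ZS; have := lo ZT.
  rewrite /P !(elS ZS, euS ZS, elT ZS, euT ZS, elS ZT, euS ZT, elT ZT, euT ZT).
  rewrite rS cS rT cT nS nT euS1 euT1 !tilde0 mST.
  by clear; lia.
- move=> X W T TW.
  pose Z : {set E} :=
    [set e | match e with Some (inl j) => j \in X | Some (inr v) => v \in W | None => false end].
  have [_] := mP Z; rewrite em.
  have rZ : row_part Z = X by apply/setP=> x; rewrite !inE.
  have cZ : col_part Z = W by apply/setP=> x; rewrite !inE.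
  have := max_excess_ub X TW; rewrite /Q rZ cZ.
  by clear; lia.
Qed.

End DegreeVectors.

(** * Covering families with prescribed degrees *)

Lemma tilde1 (E : finType) (A : {set E}) : tilde (fun=> 1) A = #|A|%:Z.
Proof. by rewrite /tilde sumr_const natz. Qed.

Lemma tilde_mem (E : finType) (A B : {set E}) :
  tilde (fun x => (x \in B)%:Z) A = #|B :&: A|%:Z.
Proof.
rewrite -tilde1 /tilde big_mkcond [RHS]big_mkcond; apply: eq_bigr => x _; rewrite inE andbC.
by case: (x \in A) => //=; case: (x \in B).
Qed.

Lemma tildeB (E : finType) (h1 h2 : E -> int) (A : {set E}) :
  tilde h1 A - tilde h2 A = tilde (fun x => h1 x - h2 x) A.
Proof. by rewrite /tilde sumrB. Qed.

Lemma card_le_tilde (E : finType) (h : E -> int) (A B : {set E}) :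
  (forall x, 0 <= h x) -> (forall x, x \in B -> 1 <= h x) -> #|A :&: B|%:Z <= tilde h A.
Proof.
move=> h0 h1; rewrite (tilde_setID h A B) -[X in X <= _]addr0; apply: lerD; last exact: sumr_ge0.
rewrite -tilde1; apply: ler_sum => x; rewrite inE => /andP[_ xB]; exact: h1.
Qed.

(* One row is peeled off: a minimal set containing {M = k+1}, contained in {M > 0} and meeting
   every Y with p Y = k+1. *)
Lemma initial_rows (V : finType) (k : nat) (M : V -> nat) (p : {set V} -> int) :
    intersecting_supermodular p -> (forall v, (M v <= k)%N) ->
    (forall Y, Y != set0 -> p Y <= k%:Z) ->
    (forall Y, Y != set0 -> p Y <= tilde (fun v => (M v)%:Z) Y) ->
  exists rs : seq {set V}, [/\ size rs = k, forall v, count (fun R : {set V} => v \in R) rs = M v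
    & forall Y, Y != set0 -> p Y <= (count (fun R : {set V} => R :&: Y != set0) rs)%:Z].
Proof.
elim: k M p => [|k IH] M p p_super Mk pk pM.
  exists [::]; split=> // v; by have := Mk v; rewrite leqn0 => /eqP ->.
pose good (R : {set V}) := [&& [forall v, (M v == k.+1) ==> (v \in R)],
    [forall v, (v \in R) ==> (0 < M v)%N]
  & [forall Y : {set V}, ((Y != set0) && (p Y == k.+1%:Z)) ==> (R :&: Y != set0)]].
pose R0 := [set v | 0 < M v]%N.
have gR0 : good R0.
  apply/and3P; split.
  - by apply/forallP=> v; apply/implyP=> /eqP e; rewrite inE e.
  - by apply/forallP=> v; rewrite inE implybb.
  - apply/forallP=> Y; apply/implyP=> /andP[Y0 /eqP e].
    apply/negP=> /eqP E; have := pM Y Y0; rewrite e /tilde big1 // => v vY.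
    by move/setP/(_ v): E; rewrite !inE vY andbT; case: (M v).
case: (arg_minnP (fun R : {set V} => #|R|) gR0) => R /and3P[/forallP R1 /forallP R2 /forallP R3] Rmin.
(* By minimality, deleting [v] violates a requirement; if M v <= k, this can only be that of a set
   [N] with p N = k+1 that [R] meets in [v] alone. *)
have Rlow v : v \in R -> (M v < k.+1)%N ->
    exists N : {set V}, [/\ N != set0, p N = k.+1%:Z & R :&: N = [set v]].
  move=> vR Mv; have: ~~ good (R :\ v).
    apply/negP=> /Rmin; rewrite (cardsD1 v R) vR; lia.
  rewrite /good; case/nandP=> [/forallPn[x]|/nandP[/forallPn[x]|/forallPn[N]]].
  - rewrite negb_imply => /andP[Mx]; rewrite !inE negb_and negbK => /orP[/eqP xv|/negP[]].
      by move: Mv; rewrite -xv (eqP Mx) ltnn.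
    exact: (implyP (R1 x)).
  - by rewrite negb_imply !inE => /andP[/andP[_ xR]] /negP[]; apply: (implyP (R2 x)).
  - rewrite negb_imply negbK => /andP[/andP[N0 /eqP pN] /eqP E].
    exists N; split=> //; have := R3 N; rewrite N0 pN eqxx /= => /set0Pn[x xN].
    apply/setP=> y; rewrite in_set1; have [->|yv] := eqVneq y v; last first.
      by move/setP/(_ y): E; rewrite !inE yv.
    move/setP/(_ x): E; rewrite !inE; case/setIP: xN => xR xN.
    by rewrite xR xN vR /= !andbT => /negbFE/eqP <-.
have M1 v : v \in R -> (0 < M v)%N by move=> vR; apply: (implyP (R2 v)).
(* It suffices to find C inside Y that meets R in one point and has M(C) >= p(Y), since the other
   points of R in Y add at least 1 each. If M v = k+1, take C = {v}. Otherwise C = N :&: Y works: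
   p(N) = k+1 exceeds p(N :|: Y), so p(Y) <= p(N :&: Y). *)
have key Y : R :&: Y != set0 -> p Y + #|R :&: Y|%:Z - 1 <= tilde (fun v => (M v)%:Z) Y.
  case/set0Pn=> v /setIP[vR vY].
  have [C [CY RC pC]] : exists C : {set V},
      [/\ C \subset Y, R :&: C = [set v] & p Y <= tilde (fun v => (M v)%:Z) C].
    have Y0 : Y != set0 by apply/set0Pn; exists v.
    have [Mv|Mv] := ltnP (M v) k.+1; last first.
      exists [set v]; split; first by rewrite sub1set.
        by apply/setIidPr; rewrite sub1set.
      rewrite /tilde big_set1; apply: le_trans (pk _ Y0) _; by rewrite lez_nat.
    have [N [N0 pN RN]] := Rlow v vR Mv.
    have vN : v \in N by have /setP/(_ v) := RN; rewrite !inE eqxx => /andP[].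
    have NY0 : N :&: Y != set0 by apply/set0Pn; exists v; rewrite inE vN.
    exists (N :&: Y); split; first exact: subsetIr.
      rewrite setIA RN; apply/setIidPl; by rewrite sub1set.
    apply: le_trans (pM _ NY0); have := p_super _ _ NY0.
    have NUY : N :|: Y != set0 by apply/set0Pn; exists v; rewrite inE vN.
    have := pk _ NUY; rewrite pN; clear; lia.
  rewrite (tilde_setID _ Y C) (setIidPr CY).
  have h0 : #|(Y :\: C) :&: R|%:Z <= tilde (fun v => (M v)%:Z) (Y :\: C).
    by apply: card_le_tilde => // x /M1; rewrite lez_nat.
  have h1 : #|R :&: Y| = #|(Y :\: C) :&: R|.+1.
    rewrite (cardsD1 v) inE vR vY add1n; congr _.+1; apply: eq_card => x.
    rewrite !inE; have /setP/(_ x) := RC; rewrite !inE.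
    have [xY|xY] := boolP (x \in Y); last by rewrite !andbF.
    by case: (x \in R); case: (x \in C) => //= <-.
  rewrite h1; clear -h0 pC; lia.
pose M' v := (M v - (v \in R))%N.
(* The indicator of being met by [R] is submodular, so subtracting it preserves intersecting
   supermodularity. *)
pose p' (Y : {set V}) : int := p Y - (R :&: Y != set0)%:Z.
have [||||rs [srs crs prs]] := IH M' p'.
- move=> A B AB; have := p_super A B AB; rewrite /p' => h.
  have c1 : R :&: (A :&: B) != set0 -> (R :&: A != set0) && (R :&: B != set0).
    by case/set0Pn=> x /setIP[xR /setIP[xA xB]]; apply/andP; split;
      apply/set0Pn; exists x; rewrite inE xR.
  have c2 : (R :&: (A :|: B) != set0) = (R :&: A != set0) || (R :&: B != set0).
    by rewrite setIUr setU_eq0 negb_and.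
  move: h c1; rewrite c2; clear.
  by case: (R :&: A != set0); case: (R :&: B != set0); case: (R :&: (A :&: B) != set0) => /=; lia.
- move=> v; rewrite /M'; have := Mk v; rewrite leq_eqVlt => /orP[Mv|]; last by clear; case: (v \in R); lia.
  by have := implyP (R1 v) Mv => ->; rewrite (eqP Mv) subn1.
- move=> Y Y0; rewrite /p'; have := pk Y Y0; have [pY|pY] := eqVneq (p Y) k.+1%:Z.
    by have := R3 Y; rewrite Y0 pY eqxx => /= ->; clear; lia.
  by move: pY; clear; case: (R :&: Y != set0) => /=; lia.
- move=> Y Y0; have eM : tilde (fun v => (M' v)%:Z) Y = tilde (fun v => (M v)%:Z) Y - #|R :&: Y|%:Z.
    rewrite -tilde_mem tildeB; apply: eq_bigr => x _; rewrite /M'; have := M1 x.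
    by clear; case: (x \in R) => /=; lia.
  rewrite eM /p'; have [RY|RY] := boolP (R :&: Y != set0).
    by have := key Y RY; clear; lia.
  move/negbNE/eqP: RY => ->; rewrite cards0; have := pM Y Y0; clear; lia.
exists (R :: rs); split=> /=; first by rewrite srs.
- move=> v; rewrite crs /M'; have := M1 v; clear; case: (v \in R) => /=; lia.
- by move=> Y Y0; have := prs Y Y0; rewrite /p'; clear; lia.
Qed.

(** * Moves between rows and the tight sets blocking them *)

Section Rows.
Variables (I V : finType) (p : {set V} -> int).
Hypothesis p_super : intersecting_supermodular p.
Implicit Types (R : {ffun I -> {set V}}) (Y N : {set V}).

Definition hits R Y : {set I} := [set j | R j :&: Y != set0].

Definition covers R : bool := [forall Y : {set V}, (Y != set0) ==> (p Y <= #|hits R Y|%:Z)].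

Definition tight R Y : bool := (Y != set0) && (p Y == #|hits R Y|%:Z).

Definition shift R i j v : {ffun I -> {set V}} :=
  [ffun h => if h == i then R i :\ v else if h == j then v |: R j else R h].

Lemma coversP R : reflect (forall Y, Y != set0 -> p Y <= #|hits R Y|%:Z) (covers R).
Proof. by apply: (iffP forallP) => h Y; [move=> Y0; have := h Y; rewrite Y0 | apply/implyP; apply: h]. Qed.

Lemma coversPn R : ~~ covers R -> exists2 N, N != set0 & #|hits R N|%:Z < p N.
Proof.
by case/forallPn=> N; rewrite negb_imply -ltNge => /andP[N0 lt]; exists N.
Qed.

Lemma hitsP R Y j : reflect (exists2 v, v \in R j & v \in Y) (j \in hits R Y).
Proof.
rewrite inE; apply: (iffP (set0Pn _)) => [[v /setIP[]]|[v vR vY]]; exists v => //.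
by rewrite inE vR.
Qed.

Lemma hitsU R A B : hits R (A :|: B) = hits R A :|: hits R B.
Proof. by apply/setP=> j; rewrite !inE setIUr setU_eq0 negb_and. Qed.

(** [#|hits R _|] is submodular, so equality holds throughout. In particular [hits R (A :&: B)],
    contained in the intersection of the two hit sets, has the same size. *)
Lemma tight_uncross R A B : covers R -> tight R A -> tight R B -> A :&: B != set0 ->
  [/\ tight R (A :&: B), tight R (A :|: B) & hits R A :&: hits R B \subset hits R (A :&: B)].
Proof.
move=> /coversP cR /andP[A0 /eqP pA] /andP[B0 /eqP pB] AB0.
have U0 : A :|: B != set0 by rewrite setU_eq0 negb_and A0.
have sI : hits R (A :&: B) \subset hits R A :&: hits R B.
  apply/subsetP=> j /hitsP[v vR /setIP[vA vB]]; rewrite inE.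
  by apply/andP; split; apply/hitsP; exists v.
have := p_super AB0; have := cR _ AB0; have := cR _ U0.
have := cardsUI (hits R A) (hits R B); rewrite -hitsU; have := subset_leq_card sI.
rewrite pA pB => h1 h2 h3 h4 h5.
have hI : p (A :&: B) = #|hits R (A :&: B)|%:Z by clear -h1 h2 h3 h4 h5; lia.
have hU : p (A :|: B) = #|hits R (A :|: B)|%:Z by clear -h1 h2 h3 h4 h5; lia.
have hh : #|hits R (A :&: B)| = #|hits R A :&: hits R B| by clear -h1 h2 h3 h4 h5; lia.
split; [by rewrite /tight AB0 hI eqxx | by rewrite /tight U0 hU eqxx |].
by have /subset_leqif_cards/leqifP := sI; rewrite hh; case: eqP => [<- // _|_]; rewrite ltnn.
Qed.

(** Only row [i] can cease to hit a set, so a violated [N] loses exactly one hit and was tight. It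
    contains no other element of row [i], and row [j] hit it before, as otherwise the arrival of [v]
    would make up for the loss. *)
Lemma shift_blocked R i j v : covers R -> v \in R i -> v \notin R j -> ~~ covers (shift R i j v) ->
  exists N, [/\ tight R N, R i :&: N = [set v] & j \in hits R N].
Proof.
move=> /coversP cR vi vj /coversPn[N N0 lt].
have ij : i != j by apply: contraNneq vj => <-.
have le := cR N N0.
have sub h : h != i -> h \in hits R N -> h \in hits (shift R i j v) N.
  move=> hi /hitsP[x xR xN]; apply/hitsP; exists x => //; rewrite ffunE (negPf hi).
  by case: eqP => // <-; rewrite inE xR orbT.
have iN : i \in hits R N.
  apply/negPn/negP=> iN; have : hits R N \subset hits (shift R i j v) N.
    by apply/subsetP=> h hN; apply: sub => //; apply: contraTneq hN => ->.
  by move/subset_leq_card; clear -le lt; lia.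
have iN' : i \notin hits (shift R i j v) N.
  apply/negP=> iN'; have : hits R N \subset hits (shift R i j v) N.
    by apply/subsetP=> h hN; have [->//|hi] := eqVneq h i; apply: sub.
  by move/subset_leq_card; clear -le lt; lia.
have RN : R i :&: N = [set v].
  have E x : x \in R i -> x \in N -> x = v.
    move=> xR xN; apply/eqP; apply: contraNT iN' => xv; apply/hitsP; exists x => //.
    by rewrite ffunE eqxx !inE xv.
  case/hitsP: iN => x xR xN; have xv := E x xR xN; apply/setP=> y; rewrite !inE.
  apply/andP/eqP => [[]|->]; first exact: E.
  by rewrite -xv.
have vN : v \in N by have /setP/(_ v) := RN; rewrite !inE eqxx => /andP[].
have jN' : j \in hits (shift R i j v) N.
  by apply/hitsP; exists v => //; rewrite ffunE eq_sym (negPf ij) eqxx !inE eqxx.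
have jN : j \in hits R N.
  apply/negPn/negP=> jN; have : j |: (hits R N :\ i) \subset hits (shift R i j v) N.
    apply/subsetP=> h; rewrite !in_setU1 !in_setD1 => /orP[/eqP->//|/andP[]]; exact: sub.
  move/subset_leq_card; rewrite cardsU1 in_setD1 (negPf jN) andbF /=.
  by have := cardsD1 i (hits R N); rewrite iN; clear -le lt; lia.
exists N; split=> //; apply/andP; split=> //; apply/eqP.
have : hits R N :\ i \subset hits (shift R i j v) N.
  by apply/subsetP=> h; rewrite in_setD1 => /andP[]; apply: sub.
by move/subset_leq_card; have := cardsD1 i (hits R N); rewrite iN; clear -le lt; lia.
Qed.

Lemma shift_col R i j v w : v \in R i -> v \notin R j ->
  #|[set h | w \in shift R i j v h]| = #|[set h | w \in R h]|.
Proof.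
move=> vi vj; have ij : i != j by apply: contraNneq vj => <-.
have [->|wv] := eqVneq w v; last first.
  apply: eq_card => h; rewrite !inE ffunE; case: eqP => [->|_]; first by rewrite !inE wv.
  by case: eqP => [->|//]; rewrite !inE (negPf wv).
have -> : [set h | v \in shift R i j v h] = j |: ([set h | v \in R h] :\ i).
  apply/setP=> h; rewrite !inE ffunE.
  have [->|hi] := eqVneq h i; first by rewrite (negPf ij) !inE eqxx.
  by have [->|hj] := eqVneq h j; rewrite ?inE ?eqxx.
rewrite cardsU1 (cardsD1 i [set h | v \in R h]) !inE vi (negPf vj) andbF /=; lia.
Qed.

Lemma shift_size R i j v h : v \in R i -> v \notin R j ->
  #|shift R i j v h|%:Z = #|R h|%:Z - (h == i)%:Z + (h == j)%:Z.
Proof.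
move=> vi vj; have ij : i != j by apply: contraNneq vj => <-.
rewrite ffunE; have [->|hi] := eqVneq h i.
  by rewrite (negPf ij) (cardsD1 v (R i)) vi; lia.
by have [->|hj] := eqVneq h j; rewrite ?cardsU1 ?vj; lia.
Qed.

(** Row [a] meets both tight sets, hence by uncrossing their intersection, in an element equal to
    both [v] and [v']. *)
Lemma tight_unique_row R a N N' v v' y : covers R -> tight R N -> tight R N' ->
  R a :&: N = [set v] -> R a :&: N' = [set v'] -> y \in N -> y \in N' -> v = v'.
Proof.
move=> cR tN tN' eN eN' yN yN'.
have NN0 : N :&: N' != set0 by apply/set0Pn; exists y; rewrite inE yN.
have [_ _ /subsetP/(_ a)] := tight_uncross cR tN tN' NN0.
rewrite !inE eN eN' -!card_gt0 !cards1 => /(_ isT); rewrite card_gt0.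
case/set0Pn=> x /setIP[xR /setIP[xN xN']].
have : x \in [set v] by rewrite -eN inE xR.
have : x \in [set v'] by rewrite -eN' inE xR.
by rewrite !inE => /eqP <- /eqP.
Qed.

(* If all moves from row a to row b are blocked, the disjoint blocking sets match R a :\: R b into
   R b :\: R a. *)
Lemma shift_down R a b : covers R -> (#|R b| < #|R a|)%N ->
  exists v, [/\ v \in R a, v \notin R b & covers (shift R a b v)].
Proof.
move=> cR lt.
case: (pickP (fun v => [&& v \in R a, v \notin R b & covers (shift R a b v)])) => [v /and3P[]|none].
  by exists v.
pose wit v y := [exists N : {set V}, [&& tight R N, R a :&: N == [set v], b \in hits R N & y \in N]].
(* [f y] is the element of row [a] whose blocking set contains [y], unique by [tight_unique_row].
   The default [y] only makes [f] total. *)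
pose f y := odflt y [pick v | wit v y].
have sub : R a :\: R b \subset f @: (R b :\: R a).
  apply/subsetP=> v /setDP[va vb].
  have nc : ~~ covers (shift R a b v) by move/negbT: (none v); rewrite va vb.
  have [N [tN eN bN]] := shift_blocked cR va vb nc.
  have /hitsP[y yb yN] := bN; apply/imsetP; exists y.
    rewrite inE yb andbT; apply/negP=> ya.
    have : y \in [set v] by rewrite -eN inE ya.
    by rewrite inE => /eqP yv; rewrite -yv yb in vb.
  rewrite /f; case: pickP => [v' /existsP[N' /and4P[tN' /eqP eN' _ yN']]|/(_ v)/negbT/negP[]].
    exact: (tight_unique_row cR tN tN' eN eN' yN yN').
  by rewrite /wit; apply/existsP; exists N; rewrite tN eN eqxx bN.
have := leq_trans (subset_leq_card sub) (leq_imset_card _ _).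
have := cardsID (R b) (R a); have := cardsID (R a) (R b); rewrite [R b :&: R a]setIC.
by clear -lt; lia.
Qed.

(** * Families of maximum weight *)

Section Optimal.
Variables (M : V -> nat) (m : I -> int).

Definition valid R : bool := covers R && [forall v, #|[set h | v \in R h]| == M v].

Definition weight R : int := \sum_j m j * #|R j|%:Z.

Definition optimal R : Prop := valid R /\ forall R', valid R' -> weight R' <= weight R.

Lemma optimal_exists R : valid R -> exists R', optimal R'.
Proof.
move=> vR; pose R' := [arg max_(R' > R | valid R') weight R']%O; exists R'; rewrite /R'.
by case: Order.TotalTheory.arg_maxP.
Qed.

Lemma weight_shift R i j v : v \in R i -> v \notin R j ->
  weight (shift R i j v) = weight R - m i + m j.
Proof.
move=> vi vj; rewrite /weight.
have E h : m h * #|shift R i j v h|%:Z =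
    m h * #|R h|%:Z - (if h == i then m h else 0) + (if h == j then m h else 0).
  by rewrite shift_size //; case: (h == i); case: (h == j); lia.
rewrite (eq_bigr _ (fun h _ => E h)) !big_split /= sumrN -!big_mkcond /= !big_pred1_eq.
by [].
Qed.

Lemma valid_shift R i j v : v \in R i -> v \notin R j ->
  [forall v, #|[set h | v \in R h]| == M v] -> covers (shift R i j v) -> valid (shift R i j v).
Proof.
move=> vi vj /forallP cM cR; rewrite /valid cR; apply/forallP=> w.
by rewrite shift_col.
Qed.

Lemma optimal_blocked R i j v : optimal R -> m i < m j -> v \in R i -> v \notin R j ->
  exists N, [/\ tight R N, R i :&: N = [set v] & j \in hits R N].
Proof.
move=> [/andP[cR cM] opt] mij vi vj; apply: shift_blocked => //; apply/negP=> cR'.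
have := opt _ (valid_shift vi vj cM cR'); rewrite weight_shift //; move: mij; clear; lia.
Qed.

Variable c : int.
Let X := [set j | c <= m j].
Definition full R := [set v | [forall (j | j \in X), v \in R j]].

(** Take a largest tight T meeting row [i] in [v] alone. If a row [l] of [X] missed T, the set
    blocking the move of [v] to [l] could be joined to T, giving a larger set of the same kind. *)
Lemma optimal_tight_row R i v : optimal R -> i \notin X -> v \in R i -> v \notin full R ->
  exists T, [/\ tight R T, R i :&: T = [set v] & X \subset hits R T].
Proof.
move=> oR iX vi; have [/andP[cR cM] opt] := oR.
have mij j : j \in X -> m i < m j.
  by move: iX; rewrite !inE -ltNge => /lt_le_trans; apply.
rewrite inE => /forallPn[j]; rewrite negb_imply => /andP[jX vj].
have [N [tN eN _]] := optimal_blocked oR (mij j jX) vi vj.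
have PN : tight R N && (R i :&: N == [set v]) by rewrite tN eN eqxx.
case: (@arg_maxnP _ N (fun N => tight R N && (R i :&: N == [set v])) (fun N : {set V} => #|N|) PN)
  => T /andP[tT /eqP eT] Tmax.
exists T; split=> //; apply/subsetP=> l lX; apply/negPn/negP=> lT.
have vT : v \in T by have /setP/(_ v) := eT; rewrite !inE eqxx => /andP[].
have vl : v \notin R l by apply: contra lT => vl; apply/hitsP; exists v.
have [N' [tN' eN' lN']] := optimal_blocked oR (mij l lX) vi vl.
have vN' : v \in N' by have /setP/(_ v) := eN'; rewrite !inE eqxx => /andP[].
have T0 : T :&: N' != set0 by apply/set0Pn; exists v; rewrite inE vT.
have [_ tU _] := tight_uncross cR tT tN' T0.
have /Tmax : tight R (T :|: N') && (R i :&: (T :|: N') == [set v]).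
  by rewrite tU setIUr eT eN' setUid eqxx.
move=> le; case/negP: lT; have : T == T :|: N' by rewrite eqEcard subsetUl.
move=> /eqP ->; rewrite hitsU inE lN' orbT //.
Qed.

(** By the last part of [tight_uncross], the tight sets containing [v] and hit by all rows of [X]
    are closed under intersection, so a smallest one is least. *)
Lemma optimal_tight_min R i v : optimal R -> i \notin X -> v \in R i -> v \notin full R ->
  exists T, [/\ tight R T, v \in T, X \subset hits R T &
    forall N, tight R N -> v \in N -> X \subset hits R N -> T \subset N].
Proof.
move=> oR iX vi vF; have [/andP[cR cM] opt] := oR.
have [T0 [tT0 eT0 XT0]] := optimal_tight_row oR iX vi vF.
have vT0 : v \in T0 by have /setP/(_ v) := eT0; rewrite !inE eqxx => /andP[].
have PT0 : [&& tight R T0, v \in T0 & X \subset hits R T0] by rewrite tT0 vT0.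
case: (@arg_minnP _ T0 (fun T => [&& tight R T, v \in T & X \subset hits R T])
  (fun N : {set V} => #|N|) PT0) => T /and3P[tT vT XT] Tmin.
exists T; split=> // N tN vN XN.
have I0 : T :&: N != set0 by apply/set0Pn; exists v; rewrite inE vT.
have [tI _ hI] := tight_uncross cR tT tN I0.
have /Tmin le : [&& tight R (T :&: N), v \in T :&: N & X \subset hits R (T :&: N)].
  by rewrite tI inE vT vN (subset_trans _ hI) // subsetI XT XN.
apply/setIidPl/eqP; by rewrite eqEcard subsetIl.
Qed.

(* T is the least tight set containing v that meets all rows of X. *)
Lemma optimal_tight_good R i v : optimal R -> i \notin X -> v \in R i -> v \notin full R ->
  exists T, [/\ tight R T, v \in T, X \subset hits R T &
    forall h, h \notin X -> (#|R h :&: T| <= 1)%N].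
Proof.
move=> oR iX vi vF; have [vR opt] := oR; have /andP[cR cM] := vR.
have [T [tT vT XT Tmin]] := optimal_tight_min oR iX vi vF.
have row g : g \notin X -> v \in R g -> R g :&: T = [set v].
  move=> gX vg; have [N [tN eN XN]] := optimal_tight_row oR gX vg vF.
  have vN : v \in N by have /setP/(_ v) := eN; rewrite !inE eqxx => /andP[].
  have TN := Tmin N tN vN XN.
  apply/eqP; rewrite eqEsubset sub1set inE vg vT andbT -eN.
  by rewrite setIS.
exists T; split=> // h hX; rewrite leqNgt; apply/negP=> h2.
have [vh|vh] := boolP (v \in R h); first by rewrite (row h hX vh) cards1 in h2.
have ih : i != h by apply: contraNneq vh => <-.
have eT := row i iX vi.
have hT : h \in hits R T by rewrite inE -card_gt0; apply: ltn_trans h2.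
(* [L] is the least tight set containing [v] and hit by row [h]. Taking [u] from [L] ensures that
   every such set contains [u]. *)
have PT : [&& tight R T, v \in T & h \in hits R T] by rewrite tT vT.
case: (@arg_minnP _ T (fun T => [&& tight R T, v \in T & h \in hits R T])
  (fun N : {set V} => #|N|) PT) => L /and3P[tL vL hL] Lmin.
have LP N : tight R N -> v \in N -> h \in hits R N -> L \subset N.
  move=> tN vN hN.
  have I0 : L :&: N != set0 by apply/set0Pn; exists v; rewrite inE vL.
  have [tI _ hI] := tight_uncross cR tL tN I0.
  have /Lmin le : [&& tight R (L :&: N), v \in L :&: N & h \in hits R (L :&: N)].
    by rewrite tI inE vL vN (subsetP hI) // inE hL hN.
  apply/setIidPl/eqP; by rewrite eqEcard subsetIl.
have /hitsP[u uh uL] := hL.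
have uT : u \in T by apply: (subsetP (LP T tT vT hT)).
have uv : u != v by apply: contraNneq vh => <-.
have ui : u \notin R i.
  apply/negP=> ui; have : u \in [set v] by rewrite -eT inE ui.
  by rewrite inE (negPf uv).
have [u' u'h u'u] : exists2 u', u' \in R h :&: T & u' != u.
  have : (0 < #|(R h :&: T) :\ u|)%N by move: h2; rewrite (cardsD1 u) inE uh uT add1n ltnS.
  by case/card_gt0P=> u' /setD1P[? ?]; exists u'.
(* Exchange v in row i with u in row h.  The result R2 is again optimal, so in R2 the move of v
   out of row h is blocked by a tight set N; N is already tight for R, so it contains T and
   hence u', although it meets row h of R2 in v only. *)
pose R1 := shift R i h v; pose R2 := shift R1 h i u.
have uR1 : u \in R1 h by rewrite ffunE eq_sym (negPf ih) eqxx inE uh orbT.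
have uR1' : u \notin R1 i by rewrite ffunE eqxx !inE (negPf ui) andbF.
have R2i : R2 i = u |: (R i :\ v) by rewrite ffunE (negPf ih) eqxx ffunE eqxx.
have R2h : R2 h = (v |: R h) :\ u by rewrite ffunE eqxx ffunE eq_sym (negPf ih) eqxx.
have R2g g : g != i -> g != h -> R2 g = R g.
  by move=> gi gh; rewrite ffunE (negPf gh) (negPf gi) ffunE (negPf gi) (negPf gh).
have hits2 N g : g != i -> g != h -> (g \in hits R2 N) = (g \in hits R N).
  by move=> gi gh; rewrite !inE R2g.
have cM1 : [forall v, #|[set h | v \in R1 h]| == M v].
  by apply/forallP=> w; rewrite shift_col //; apply: (forallP cM).
have W2 : weight R2 = weight R by rewrite weight_shift // weight_shift //; clear; lia.
have cmp (S S2 : {set I}) : (forall g, g != i -> g != h -> (g \in S2) = (g \in S)) ->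
    (#|S2| + (i \in S) + (h \in S) = #|S| + (i \in S2) + (h \in S2))%N.
  move=> E; rewrite (cardsD1 i S) (cardsD1 h (S :\ i)) (cardsD1 i S2) (cardsD1 h (S2 :\ i)).
  have -> : (S2 :\ i) :\ h = (S :\ i) :\ h.
    apply/setP=> g; rewrite !inE; case: (eqVneq g h) => //= gh; case: (eqVneq g i) => //= gi.
    exact: E.
  by rewrite !in_setD1 eq_sym ih /=; clear; lia.
(* A violated [N] must be tight for [R] and lose exactly one of the rows [i], [h]. If [h] is lost,
   uncrossing with [T] shows that row [i] meets [N] in [v], which keeps [h]. If [i] is lost, [N]
   contains [L], hence [u], which keeps [i]. *)
have cR2 : covers R2.
  apply/negPn/negP=> /coversPn[N N0 lt]; have le := coversP _ cR N N0.
  have vN2 : v \in N -> h \in hits R2 N.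
    by move=> vN; apply/hitsP; exists v; rewrite // R2h !inE eqxx eq_sym uv.
  have uN2 : u \in N -> i \in hits R2 N.
    by move=> uN; apply/hitsP; exists u; rewrite // R2i !inE eqxx.
  have iN2 : i \notin hits R2 N -> i \in hits R N -> v \in N.
    move=> n2 /hitsP[x xi xN]; have [<-//|xv] := eqVneq x v.
    by case/negP: n2; apply/hitsP; exists x; rewrite // R2i !inE xv xi orbT.
  have hN2 : h \notin hits R2 N -> h \in hits R N -> u \in N.
    move=> n2 /hitsP[x xi xN]; have [<-//|xv] := eqVneq x u.
    by case/negP: n2; apply/hitsP; exists x; rewrite // R2h !inE xv xi orbT.
  have := cmp (hits R N) (hits R2 N) (hits2 N).
  have [i2|i2] := boolP (i \in hits R2 N); have [h2'|h2'] := boolP (h \in hits R2 N).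
  - by case: (i \in hits R N); case: (h \in hits R N); move: le lt; clear; lia.
  - have [hR|hR] := boolP (h \in hits R N); last by case: (i \in hits R N); move: le lt; clear; lia.
    have [iR|iR] := boolP (i \in hits R N); last by move: le lt; clear; lia.
    move=> card; have tN : tight R N by rewrite /tight N0; apply/eqP; move: le lt card; clear; lia.
    have uN := hN2 h2' hR.
    have vN : v \notin N by apply: contra h2' => /vN2.
    have I0 : T :&: N != set0 by apply/set0Pn; exists u; rewrite inE uT.
    have [_ _ /subsetP/(_ i)] := tight_uncross cR tT tN I0.
    rewrite in_setI iR andbT => /(_ _)/hitsP[].
      by apply/hitsP; exists v.
    move=> x xi /setIP[xT xN]; have : x \in [set v] by rewrite -eT inE xi.
    by rewrite inE => /eqP xv; rewrite -xv xN in vN.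
  - have [iR|iR] := boolP (i \in hits R N); last by case: (h \in hits R N); move: le lt; clear; lia.
    have [hR|hR] := boolP (h \in hits R N); last by move: le lt; clear; lia.
    move=> card; have tN : tight R N by rewrite /tight N0; apply/eqP; move: le lt card; clear; lia.
    have vN := iN2 i2 iR.
    by case/negP: i2; apply: uN2; apply: (subsetP (LP N tN vN hR)).
  - have vN : v \notin N by apply: contra h2' => /vN2.
    have uN : u \notin N by apply: contra i2 => /uN2.
    have iR : i \notin hits R N by apply: contra vN; apply: iN2.
    have hR : h \notin hits R N by apply: contra uN; apply: hN2.
    by rewrite (negPf iR) (negPf hR); move: le lt; clear; lia.
have oR2 : optimal R2.
  split; first exact: valid_shift.
  by move=> R' /opt; rewrite W2.
have vh2 : v \in R2 h by rewrite R2h !inE eqxx eq_sym uv.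
have Xih j : j \in X -> R2 j = R j.
  by move=> jX; apply: R2g; [apply: contraNneq iX | apply: contraNneq hX] => <-.
have vF2 : v \notin full R2.
  apply: contra vF; rewrite !inE => /forall_inP H; apply/forall_inP=> j jX.
  by rewrite -Xih //; apply: H.
have [N [tN eN XN]] := optimal_tight_row oR2 hX vh2 vF2.
have vN : v \in N by have /setP/(_ v) := eN; rewrite !inE eqxx => /andP[].
have XN' : X \subset hits R N.
  by apply/subsetP=> j jX; have := subsetP XN j jX; rewrite !inE Xih.
(* Row [h] of [R2] hits [N] through [v], and row [i] of [R] does too. If [u] is not in [N], row [h]
   of [R] misses [N], which offsets a possible loss of row [i]. *)
have sub : (#|hits R N| <= #|hits R2 N|)%N.
  have iR : i \in hits R N by apply/hitsP; exists v.
  have h2N : h \in hits R2 N by apply/hitsP; exists v.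
  have := cmp (hits R N) (hits R2 N) (hits2 N); rewrite iR h2N.
  have [uN|uN] := boolP (u \in N).
    have -> : i \in hits R2 N by apply/hitsP; exists u; rewrite // R2i !inE eqxx.
    by case: (h \in hits R N); clear; lia.
  have -> : h \in hits R N = false.
    apply/hitsP=> -[x xh xN]; have : x \in [set v].
      rewrite -eN inE xN R2h !inE xh orbT !andbT.
      by apply: contraNneq uN => <-.
    by rewrite inE => /eqP xv; rewrite -xv xh in vh.
  by case: (i \in hits R2 N); clear; lia.
have tN' : tight R N.
  case/andP: tN => N0 /eqP pN; rewrite /tight N0; have := coversP _ cR N N0.
  by rewrite pN eq_le => ->; rewrite lez_nat.
have /subsetP/(_ u') := Tmin N tN' vN XN'.
case/setIP: u'h => u'h u'T /(_ u'T) u'N.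
have : u' \in [set v] by rewrite -eN inE u'N R2h !inE u'u u'h orbT.
by rewrite inE => /eqP u'v; rewrite -u'v u'h in vh.
Qed.
End Optimal.
End Rows.

Lemma double_count (I V : finType) (R : I -> {set V}) (W : {set V}) (X : {set I}) :
  tilde (fun v => #|[set h in X | v \in R h]|%:Z) W = tilde (fun h => #|R h :&: W|%:Z) X.
Proof.
rewrite /tilde; under [RHS]eq_bigr do rewrite -tilde_mem /tilde.
rewrite exchange_big /=; apply: eq_bigr => v _.
have -> : [set h in X | v \in R h] = [set h | v \in R h] :&: X.
  by apply/setP=> h; rewrite !inE andbC.
by rewrite -tilde_mem /tilde; apply: eq_bigr => h _; rewrite inE.
Qed.

Section Threshold.
Variables (I V : finType) (p : {set V} -> int).
Hypothesis p_super : intersecting_supermodular p.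
Variables (M : V -> nat) (m : I -> int) (c : int) (R : {ffun I -> {set V}}).
Hypothesis oR : optimal p M m R.
Let X := [set j | c <= m j].

(** Exactly the sets for which p(T) equals |X| plus the number of entries in T of the rows outside
    [X], so that the cut inequality is sharp on them. *)
Definition good (T : {set V}) : bool :=
  [&& tight p R T, X \subset hits R T & [forall (h | h \notin X), #|R h :&: T| <= 1]%N].

(** A row outside [X] meeting both sets meets their intersection, so its two single-element traces
    coincide. *)
Lemma goodU A B : good A -> good B -> A :&: B != set0 -> good (A :|: B).
Proof.
case: (oR) => /andP[cR _] _.
move=> /and3P[tA XA /forall_inP lA] /and3P[tB XB /forall_inP lB] AB0.
have [_ tU hI] := tight_uncross p_super cR tA tB AB0.
apply/and3P; split=> //; first by rewrite hitsU subsetU // XA.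
apply/forall_inP=> h hX; rewrite setIUr.
have [/eqP ->|nA] := boolP (R h :&: A == set0); first by rewrite set0U lB.
have [/eqP ->|nB] := boolP (R h :&: B == set0); first by rewrite setU0 lA.
have : h \in hits R (A :&: B) by apply: (subsetP hI); rewrite !inE nA.
case/hitsP=> x xh /setIP[xA xB].
have eA : R h :&: A = [set x].
  by apply/eqP; rewrite eq_sym eqEcard sub1set inE xh xA cards1 lA.
have eB : R h :&: B = [set x].
  by apply/eqP; rewrite eq_sym eqEcard sub1set inE xh xB cards1 lB.
by rewrite eA eB setUid cards1.
Qed.

(* T consists of the maximal good sets. *)
Lemma optimal_threshold : exists (W : {set V}) (T : {set {set V}}), subpartition T W /\
  tilde (fun j => #|R j|%:Z) X + excess p X W T = tilde (fun v => (M v)%:Z) W.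
Proof.
have [/andP[cR /forallP cM] _] := oR.
pose F := [set T | maxset good T].
have Fgood T : T \in F -> good T by rewrite inE => /maxsetp.
have tF : trivIset F.
  apply/trivIsetP=> A B; rewrite !inE => mA mB; apply: contraR; rewrite -setI_eq0 => AB0.
  have gU := goodU (maxsetp mA) (maxsetp mB) AB0.
  by rewrite -(maxsetsup mA gU (subsetUl _ _)) -{2}(maxsetsup mB gU (subsetUr _ _)).
have nF : set0 \notin F.
  by apply/negP=> /Fgood/and3P[/andP[]]; rewrite eqxx.
(* Columns outside [W] lie in every row of [X], and rows outside [X] meet [W] only inside [cover F];
   both estimates behind the cut condition become equalities. *)
pose W := ~: (full m c R :\: cover F).
have covW : cover F \subset W.
  by apply/subsetP=> x xF; rewrite !inE xF.
have out h : h \notin X -> R h :&: W = R h :&: cover F.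
  move=> hX; apply/setP=> v; rewrite !in_setI; case vh: (v \in R h) => //=.
  apply/idP/idP => [|/(subsetP covW)//]; rewrite in_setC in_setD negb_and negbK.
  case/orP=> // vF; have [T [tT vT XT lT]] := optimal_tight_good p_super oR hX vh vF.
  have gT : good T by apply/and3P; split=> //; apply/forall_inP.
  have [T' mT' sT'] := maxset_exists gT.
  by apply/bigcupP; exists T'; [rewrite inE | apply: (subsetP sT')].
exists W, F; split; first by apply/and3P.
have pF T : T \in F -> p T = #|X|%:Z + tilde (fun h => #|R h :&: T|%:Z) (~: X).
  move/Fgood=> /and3P[/andP[_ /eqP ->] XT /forall_inP lT].
  rewrite -(cardsID X) (setIidPr XT) PoszD; congr (_ + _).
  rewrite setDE -tilde_mem; apply: eq_bigr => h; rewrite in_setC => hX; congr Posz.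
  by rewrite inE -card_gt0; case: #|_| (lT h hX) => [|[]].
have eM : tilde (fun v => (M v)%:Z) W = tilde (fun h => #|R h :&: W|%:Z) setT.
  rewrite -double_count; apply: eq_bigr => v _; rewrite -(eqP (cM v)); congr Posz.
  by apply: eq_card => h; rewrite !inE.
have eF : tilde p F = #|X|%:Z * #|F|%:Z + tilde (fun h => #|R h :&: W|%:Z) (~: X).
  rewrite /tilde (eq_bigr _ (fun T TF => pF T TF)) big_split /= sumr_const -mulr_natr natz.
  congr (_ + _); rewrite exchange_big; apply: eq_bigr => h; rewrite in_setC => hX.
  rewrite out // -tilde_mem /tilde big_trivIset //.
  by apply: eq_bigr => T _; rewrite -tilde_mem.
have eX : tilde (fun j => #|R j|%:Z) X = tilde (fun h => #|R h :&: W|%:Z) X + #|X|%:Z * #|~: W|%:Z.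
  rewrite -[#|X|%:Z]tilde1 /tilde mulr_suml -big_split /=; apply: eq_bigr => j jX.
  rewrite mul1r -PoszD; congr Posz; rewrite -(cardsID W); congr addn.
  apply: eq_card => v; rewrite inE in_setC; case vW: (v \in W) => //=.
  move: vW; rewrite in_setC in_setD => /negbFE/andP[_]; by rewrite inE => /forall_inP/(_ j jX) ->.
rewrite /excess eM eX eF [tilde _ setT](tildeC _ X); ring.
Qed.
End Threshold.

Lemma count_card (I : finType) (T : Type) (x0 : T) (s : seq T) (P : pred T) :
  size s = #|I| -> #|[set j : I | P (nth x0 s (enum_rank j))]| = count P s.
Proof.
move=> ss; rewrite -sum1_count (big_nth x0) big_mkord ss -sum1_card.
rewrite (reindex (@enum_rank I)) /=; last first.
  by exists enum_val => j _; [apply: enum_rankK | apply: enum_valK].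
by apply: eq_bigl => j; rewrite inE.
Qed.

Lemma tilde_lt_exists (E : finType) (h1 h2 : E -> int) (A : {set E}) :
  tilde h1 A < tilde h2 A -> exists2 x, x \in A & h1 x < h2 x.
Proof.
move=> lt; apply/exists_inP; apply: contraLR lt => /exists_inPn le; rewrite -leNgt.
by apply: ler_sum => x xA; rewrite leNgt; apply: le.
Qed.

Lemma tilde_lt (E : finType) (h1 h2 : E -> int) (A : {set E}) x :
  (forall y, y \in A -> h1 y <= h2 y) -> x \in A -> h1 x < h2 x -> tilde h1 A < tilde h2 A.
Proof.
move=> le xA lt; rewrite /tilde (bigD1 x) //= [ltRHS](bigD1 x) //=.
by apply: ltr_leD => //; apply: ler_sum => y /andP[yA _]; apply: le.
Qed.

(** * Prescribed row sizes *)

Section Specified.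
Variables (I V : finType) (p : {set V} -> int).
Hypothesis p_super : intersecting_supermodular p.

(** Minimize the total deviation from [m]. If it is positive, a move from a surplus row [a] to a
    deficient row [b], both with [m] as large as possible, lowers it. *)
Lemma rows_of_sizes (M : V -> nat) (m : I -> int) (R0 : {ffun I -> {set V}}) :
    valid p M R0 -> tilde m setT = tilde (fun j => #|R0 j|%:Z) setT ->
    (forall c, tilde m [set j | c <= m j] <= tilde (fun j => #|R0 j|%:Z) [set j | c <= m j]) ->
  exists2 R, valid p M R & forall j, #|R j|%:Z = m j.
Proof.
move=> v0 sum0 th0.
pose d (R : {ffun I -> {set V}}) j : int := #|R j|%:Z.
pose X l := [set j | m l <= m j].
pose P R := [&& valid p M R, tilde m setT == tilde (d R) setT
             & [forall l, tilde m (X l) <= tilde (d R) (X l)]].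
have P0 : P R0.
  by rewrite /P v0 sum0 eqxx; apply/forallP=> l; apply: th0.
pose dev R := (\sum_j `|d R j - m j|)%N.
case: (@arg_minnP _ R0 P dev P0) => R /and3P[vR /eqP sumR /forallP thR] Rmin.
exists R => // j0; apply/eqP/negPn/negP=> neq.
have [cR cM] := andP vR.
have tot : exists a, m a < d R a /\ exists b, d R b < m b.
  have [lt|gt|eq] := ltgtP (d R j0) (m j0).
  - have /tilde_lt_exists[a _ ma] : tilde m (~: [set j0]) < tilde (d R) (~: [set j0]).
      by move: sumR lt; rewrite !(tildeC _ [set j0]) /tilde !big_set1; clear; lia.
    by exists a; split=> //; exists j0.
  - have /tilde_lt_exists[b _ mb] : tilde (d R) (~: [set j0]) < tilde m (~: [set j0]).
      by move: sumR gt; rewrite !(tildeC _ [set j0]) /tilde !big_set1; clear; lia.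
    by exists j0; split=> //; exists b.
  - by rewrite -eq /d eqxx in neq.
case: tot => a0 [a0P [b0 b0P]].
have [a [aP amax]] : exists a, m a < d R a /\ forall j, m j < d R j -> m j <= m a.
  pose a := [arg max_(a > a0 | m a < d R a) m a]%O; exists a; rewrite /a.
  by case: Order.TotalTheory.arg_maxP.
have [b [bP bmax]] : exists b, d R b < m b /\ forall j, d R j < m j -> m j <= m b.
  pose b := [arg max_(b > b0 | d R b < m b) m b]%O; exists b; rewrite /b.
  by case: Order.TotalTheory.arg_maxP.
(* Otherwise the threshold set at [m b] contains no surplus row but the deficient row [b], so it
   would be short. It follows that row [a] is longer than row [b]. *)
have mba : m b <= m a.
  rewrite leNgt; apply/negP=> mab; have := thR b; rewrite leNgt => /negP; apply.
  apply: (tilde_lt (x := b)) => //; last by rewrite inE.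
  move=> j; rewrite inE => mbj; rewrite leNgt; apply/negP=> /amax mja.
  by have := lt_le_trans mab (le_trans mbj mja); rewrite ltxx.
have dba : (#|R b| < #|R a|)%N.
  by have := lt_le_trans bP (le_trans mba (ltW aP)); rewrite /d ltz_nat.
have [v [va vb cR']] := shift_down p_super cR dba.
have ab : a != b by apply: contraNneq vb => <-.
pose R' := shift R a b v.
have dR' j : d R' j = d R j - (j == a)%:Z + (j == b)%:Z by rewrite /d shift_size.
have tR' A : tilde (d R') A = tilde (d R) A - (a \in A)%:Z + (b \in A)%:Z.
  have ind (x : I) : tilde (fun j => (j == x)%:Z) A = (x \in A)%:Z.
    rewrite /tilde (eq_bigr (fun j => (j \in [set x])%:Z)); last by move=> j _; rewrite inE.
    rewrite [LHS]tilde_mem; congr Posz; have [xA|xA] := boolP (x \in A).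
      by rewrite (setIidPl _) ?cards1 // sub1set.
    by rewrite disjoint_setI0 ?cards0 // disjoints1.
  rewrite -!ind /tilde -sumrN -!big_split /=; apply: eq_bigr => j _; exact: dR'.
have PR' : P R'.
  apply/and3P; split.
  - exact: valid_shift.
  - by rewrite tR' !inE sumR subrK.
  - apply/forallP=> l; rewrite tR'; have thl := thR l.
    have [aX|aX] := boolP (a \in X l); last by move: thl; clear; lia.
    have [bX|bX] := boolP (b \in X l); first by move: thl; clear; lia.
    (* Deficient rows have [m] at most [m b], which lies below this threshold; so only surpluses
       occur in [X l], among them that of [a]. *)
    suff : tilde m (X l) < tilde (d R) (X l) by clear; lia.
    apply: (tilde_lt (x := a)) => // j; rewrite inE => mlj; rewrite leNgt; apply/negP=> /bmax mjb.
    by case/negP: bX; rewrite inE (le_trans mlj).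
have := Rmin R' PR'; rewrite leqNgt => /negP; apply.
rewrite /dev (bigD1 a) // (bigD1 b) 1?eq_sym //= [ltnRHS](bigD1 a) // [in ltnRHS](bigD1 b) 1?eq_sym //=.
rewrite (eq_bigr (fun j => absz (d R j - m j))); last first.
  by move=> j /andP[ja jb]; rewrite dR' (negPf ja) (negPf jb) subr0 addr0.
rewrite !addnA ltn_add2r !dR' !eqxx [b == a]eq_sym (negPf ab).
by move: aP bP; clear; lia.
Qed.

Lemma degree_specified (mS : I -> int) (mT : V -> nat) :
    (forall v, (mT v <= #|I|)%N) -> tilde mS setT = tilde (fun v => (mT v)%:Z) setT ->
    (forall (X : {set I}) W T, subpartition T W ->
       tilde mS X + excess p X W T <= tilde (fun v => (mT v)%:Z) W) ->
  exists R : {ffun I -> {set V}},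
    [/\ covers p R, forall v, #|[set j | v \in R j]| = mT v & forall j, #|R j|%:Z = mS j].
Proof.
move=> mTk tot cond.
have sub1 (Y : {set V}) : Y != set0 -> forall W : {set V}, Y \subset W -> subpartition [set Y] W.
  move=> Y0 W YW; apply/and3P; split; first exact: trivIset1.
    by rewrite in_set1 eq_sym.
  by rewrite /cover big_set1.
(* The subpartition with the single member [Y] gives this bound for [X = setT] and the next one for
   [X = set0]. *)
have pk Y : Y != set0 -> p Y <= #|I|%:Z.
  move=> Y0; have := cond setT setT _ (sub1 Y Y0 _ (subsetT _)).
  by rewrite /excess tot cardsT cards1 setCT cards0 /tilde big_set1; clear; lia.
have pM Y : Y != set0 -> p Y <= tilde (fun v => (mT v)%:Z) Y.
  move=> Y0; have := cond set0 Y _ (sub1 Y Y0 _ (subxx _)).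
  by rewrite /excess cards0 !mul0r !subr0 tilde0 add0r {1}/tilde big_set1.
have [rs [srs crs prs]] := initial_rows p_super mTk pk pM.
pose R0 : {ffun I -> {set V}} := [ffun j => nth set0 rs (enum_rank j)].
have vR0 : valid p mT R0.
  apply/andP; split.
    apply/coversP=> Y Y0; apply: le_trans (prs Y Y0) _.
    rewrite lez_nat -(count_card set0 _ srs) subset_leq_card //.
    by apply/subsetP=> j; rewrite !inE ffunE.
  apply/forallP=> v; rewrite -crs -(count_card set0 _ srs); apply/eqP/eq_card => j.
  by rewrite !inE ffunE.
have [R1 oR1] := optimal_exists mS vR0.
have [v1 _] := oR1; have [c1 /forallP cM1] := andP v1.
have [|c|R /andP[cR /forallP cM] sR] := @rows_of_sizes mT mS R1 v1.
- rewrite tot; transitivity (tilde (fun v => #|[set h in setT | v \in R1 h]|%:Z) setT).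
    apply: eq_bigr => v _; rewrite -(eqP (cM1 v)); congr Posz.
    by apply: eq_card => h; rewrite !inE.
  rewrite double_count; apply: eq_bigr => h _; by rewrite setIT.
- have [W [T [TW eq]]] := optimal_threshold p_super c oR1.
  by have := cond [set j | c <= mS j] W T TW; rewrite -eq lerD2r.
exists R; split=> // v; exact/eqP.
Qed.
End Specified.

(** * Disjoint branchings with prescribed root sets *)

Lemma uniq_map_inj (T1 T2 : eqType) (f : T1 -> T2) (s : seq T1) :
  uniq (map f s) -> {in s &, injective f}.
Proof.
move=> u x y xs ys e; rewrite -(nth_index x xs) -(nth_index x ys); congr nth; apply/eqP.
rewrite -(nth_uniq (f x) _ _ u) ?size_map ?index_mem //.
by rewrite !(nth_map x) ?index_mem // !nth_index // e.
Qed.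

Section Branchings.
Variables (V A : finType) (D : digraph V A).
Implicit Types (a : A) (B F : {set A}) (Y : {set V}).

Definition entering F Y : {set A} := [set a in F | (arc_tail D a \notin Y) && (arc_head D a \in Y)].

Lemma varrho_submodular F Y Z :
  (varrho D F (Y :&: Z) + varrho D F (Y :|: Z) <= varrho D F Y + varrho D F Z)%N.
Proof.
rewrite -!/(#|entering _ _|) -cardsUI -[leqRHS]cardsUI; apply: leq_add;
  apply: subset_leq_card; apply/subsetP=> a; rewrite !inE; case: (a \in F) => //=; case: (arc_tail D a \in Y); case: (arc_tail D a \in Z);
  by case: (arc_head D a \in Y); case: (arc_head D a \in Z).
Qed.

Lemma deficiency_supermodular (k : int) F : intersecting_supermodular (fun Y => k - (varrho D F Y)%:Z).
Proof. by move=> Y Z _; have := varrho_submodular F Y Z; clear; lia. Qed.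

(** A certificate of acyclicity that, unlike the absence of circuits, is easily carried along when
    an arc is added. *)
Definition increasing (dep : V -> nat) B : Prop :=
  forall a, a \in B -> (dep (arc_tail D a) < dep (arc_head D a))%N.

(* In an undirected circuit, both arcs at a node of maximal dep would enter it. *)
Lemma increasing_branching dep B : increasing dep B ->
  (forall v, varrho D B [set v] <= 1)%N -> branching D B.
Proof.
move=> inc deg; split=> // c; apply/negP=> /and5P[c0 u1 u2 /allP cB cyc].
have uc : uniq c := map_uniq u1.
case: c c0 u1 u2 cB cyc uc => [//|x0 c'] _; set c := x0 :: c' => u1 u2 cB cyc uc.
have [x xc xmax] : exists2 x, x \in c & forall y, y \in c -> (dep y.1 <= dep x.1)%N.
  case: (@arg_maxnP _ (Ordinal (ltn0Sn (size c'))) predT (fun i => dep (nth x0 c i).1) isT)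
    => i _ imax.
  exists (nth x0 c i); first by apply: mem_nth.
  move=> y yc; have lt : (index y c < (size c').+1)%N by rewrite index_mem.
  by have := imax (Ordinal lt) isT; rewrite /= nth_index.
have nx := next_cycle cyc xc; have px := prev_cycle cyc xc.
have nc : next c x \in c by rewrite mem_next.
have pc : prev c x \in c by rewrite mem_prev.
have ent y a : a \in B -> (dep y <= dep x.1)%N -> joins D a x.1 y ->
    a \in entering B [set x.1] /\ arc_tail D a = y.
  move=> aB le /orP[] /andP[/eqP ta /eqP ha]; have := inc a aB; rewrite ta ha.
    by rewrite ltnNge le.
  move=> lt; split=> //; rewrite !inE aB ta ha eqxx andbT.
  by apply: contraTneq lt => ->; rewrite ltnn.
have [e1 t1] := ent _ _ (cB x xc) (xmax _ nc) nx.
have [e2 _] : (prev c x).2 \in entering B [set x.1] /\ arc_tail D (prev c x).2 = (prev c x).1.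
  (* In-degree at most one makes the two arcs at [x] equal. Arcs of a circuit are distinct, so the
     circuit is a loop, which [dep] forbids. *)
  by apply: ent (cB _ pc) (xmax _ pc) _; rewrite /joins orbC.
have eq2 : (prev c x).2 = x.2.
  by apply/eqP; have /card_le1_eqP/(_ _ _ e2 e1) -> := deg x.1.
have xp : prev c x = x.
  exact: (uniq_map_inj u2 pc xc eq2).
have : next c x = x by rewrite -{1}xp next_prev.
move=> nxx; have := inc _ (cB x xc); move: e1; rewrite !inE t1 nxx eqxx andbF //.
Qed.

(* Lovasz' proof of Edmonds' theorem: the arc to be added to B j leaves R j inside a minimal tight
   set M that meets R j without being contained in it. *)
Lemma disjoint_growing (I : finType) F (R : {ffun I -> {set V}}) :
    covers (fun Y => #|I|%:Z - (varrho D F Y)%:Z) R ->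
  exists B : I -> {set A}, [/\ forall j, B j \subset F, forall i j, i != j -> [disjoint B i & B j]
    & forall j, exists2 dep, increasing dep (B j) & forall v, varrho D (B j) [set v] = (v \notin R j)].
Proof.
move: {2}(\sum_j #|~: R j|)%N (leqnn (\sum_j #|~: R j|)%N) => n.
have empty F' (R' : {ffun I -> {set V}}) : (forall j, (R' j != setT) = false) ->
    exists B : I -> {set A}, [/\ forall j, B j \subset F', forall i j, i != j -> [disjoint B i & B j]
    & forall j, exists2 dep, increasing dep (B j) & forall v, varrho D (B j) [set v] = (v \notin R' j)].
  move=> full; exists (fun=> set0); split=> [j|i j _|j]; first exact: sub0set.
    by rewrite -setI_eq0 setI0.
  exists (fun=> 0%N) => [a|v]; first by rewrite inE.
  have /negbFE/eqP -> := full j; rewrite inE; apply/eqP; rewrite cards_eq0; apply/eqP/setP=> a.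
  by rewrite !inE.
elim: n F R => [|n IH] F R le cR; case: (pickP (fun j => R j != setT)) => [j Rj|full].
- move: le; rewrite leqn0 sum_nat_eq0 => /forallP/(_ j); rewrite /= cards_eq0 => /eqP e.
  by rewrite -[R j]setCK e setC0 eqxx in Rj.
- exact: empty full.
2: exact: empty full.
have p_super := deficiency_supermodular #|I|%:Z F.
set p := (fun Y => _) in cR p_super.
have [v0 v0R] : exists v, v \notin R j.
  apply/existsP; rewrite -negb_forall; apply: contra Rj => /forallP h.
  by apply/eqP/setP=> v; rewrite h inE.
(* No arc enters the whole node set, so it demands all |I| rows. This provides a starting candidate
   for [M]. *)
have tT : tight p R setT.
  have T0 : [set: V] != set0 by apply/set0Pn; exists v0.
  rewrite /tight T0 eq_le (coversP _ _ cR _ T0) /p.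
  have -> : varrho D F setT = 0%N.
    by apply/eqP; rewrite cards_eq0; apply/eqP/setP=> a; rewrite !inE andbF.
  by rewrite subr0 lez_nat max_card.
have jT : j \in hits R setT.
  case/andP: tT => T0 /eqP; rewrite /p; have -> : varrho D F setT = 0%N.
    by apply/eqP; rewrite cards_eq0; apply/eqP/setP=> a; rewrite !inE andbF.
  rewrite subr0 => -[]/esym/eqP; rewrite -cardsT => /eqP e.
  have : hits R setT == setT by rewrite eqEcard subsetT e leqnn.
  by move/eqP ->; rewrite inE.
have PT : [&& tight p R setT, j \in hits R setT & [exists v in setT, v \notin R j]].
  by rewrite tT jT; apply/exists_inP; exists v0.
case: (@arg_minnP _ setT
  (fun M : {set V} => [&& tight p R M, j \in hits R M & [exists v in M, v \notin R j]])
  (fun M : {set V} => #|M|) PT) => M /and3P[tM jM /exists_inP[w wM wR]] Mmin.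
have cRp := coversP _ _ cR.
(* Row [j] hits [M] but not [M :\: R j], so more arcs enter the latter than the tight set [M]. An
   arc entering only the latter has its tail in [M :&: R j]. *)
have [a [aF [aM aR] [bM bR]]] : exists a, [/\ a \in F, arc_tail D a \in M /\ arc_tail D a \in R j
    & arc_head D a \in M /\ arc_head D a \notin R j].
  have MR0 : M :\: R j != set0 by apply/set0Pn; exists w; rewrite inE wM wR.
  have /andP[_ /eqP pM] := tM.
  have sub : hits R (M :\: R j) \subset hits R M :\ j.
    apply/subsetP=> i /hitsP[x xi /setDP[xM xj]]; rewrite !in_setD1; apply/andP; split.
      by apply: contraNneq xj => <-.
    by apply/hitsP; exists x.
  have lt : (#|entering F M| < #|entering F (M :\: R j)|)%N.
    have := cRp _ MR0; have := subset_leq_card sub; have := cardsD1 j (hits R M).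
    rewrite jM; move: pM; rewrite /p /varrho -!/(entering _ _); clear; lia.
  have /subsetPn[a] : ~~ (entering F (M :\: R j) \subset entering F M).
    by apply: contraTN lt => /subset_leq_card; rewrite leqNgt.
  rewrite !inE => /andP[aF]; rewrite aF negb_and /= => /andP[]; rewrite negb_and negbK.
  move=> h1 /andP[h2 h3]; rewrite h3 /= orbF negbK => aM; rewrite aM orbF in h1.
  by exists a.
set u := arc_tail D a in aM aR; set v := arc_head D a in bM bR.
pose R' : {ffun I -> {set V}} := [ffun h => if h == j then v |: R j else R h].
have R'j : R' j = v |: R j by rewrite ffunE eqxx.
have R'n h : h != j -> R' h = R h by move=> hj; rewrite ffunE (negPf hj).
have sub' N : hits R N \subset hits R' N.
  apply/subsetP=> h /hitsP[x xh xN]; apply/hitsP; exists x => //; rewrite ffunE.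
  by case: eqP => [<-|//]; rewrite inE xh orbT.
have cR' : covers (fun Y => #|I|%:Z - (varrho D (F :\ a) Y)%:Z) R'.
  (* A violated [N] is entered by [a], was tight and gained no row, so row [j] already hit it. Then
     [M :&: N] still contains [v] but not [u], contradicting the minimality of [M]. *)
  apply/negPn/negP=> /coversPn[N N0 lt].
  have le' := cRp N N0; have sc := subset_leq_card (sub' N).
  have eD : (#|entering F N| <= #|entering (F :\ a) N| + (a \in entering F N))%N.
    rewrite (cardsD1 a) addnC leq_add2r; apply: subset_leq_card; apply/subsetP=> b.
    by rewrite !inE => /andP[-> /andP[->]].
  have aN : a \in entering F N.
    apply/negPn/negP=> aN; move: eD; rewrite (negPf aN) addn0.
    by move: lt le' sc; rewrite /p /varrho -!/(entering _ _); clear; lia.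
  have card : #|hits R N| = #|hits R' N|.
    by move: eD lt le' sc; rewrite aN /p /varrho -!/(entering _ _); clear; lia.
  have tN : tight p R N.
    rewrite /tight N0; apply/eqP.
    by move: eD lt le' sc; rewrite aN /p /varrho -!/(entering _ _); clear; lia.
  move: (aN); rewrite !inE aF /= -/u -/v => /andP[uN vN].
  have hh : hits R N = hits R' N by apply/eqP; rewrite eqEcard sub' card leqnn.
  have jN : j \in hits R N by rewrite hh; apply/hitsP; exists v; rewrite ?R'j ?inE ?eqxx.
  have I0 : M :&: N != set0 by apply/set0Pn; exists v; rewrite inE bM.
  have [tI _ /subsetP/(_ j)] := tight_uncross p_super cR tM tN I0.
  rewrite in_setI jM jN => /(_ isT) jI.
  have /Mmin : [&& tight p R (M :&: N), j \in hits R (M :&: N) & [exists v in M :&: N, v \notin R j]].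
    by rewrite tI jI; apply/exists_inP; exists v; rewrite // inE bM.
  rewrite leqNgt => /negP; apply; apply: proper_card; apply/properP; split; first exact: subsetIl.
  by exists u; rewrite // inE aM.
have le2 : (\sum_j #|~: R' j| <= n)%N.
  move: le; rewrite (bigD1 j) //= [in X in _ -> X](bigD1 j) //=.
  rewrite [in X in _ -> X](eq_bigr (fun h => #|~: R h|)) => [|h /R'n -> //].
  have -> : #|~: R j| = #|~: R' j|.+1.
    rewrite (cardsD1 v) inE bR add1n; congr _.+1; apply: eq_card => x.
    by rewrite R'j !inE negb_or.
  by rewrite addSn ltnS.
have [B [BF Bd Bg]] := IH _ _ le2 cR'.
have aB h : a \notin B h by apply/negP=> /(subsetP (BF h)); rewrite !inE eqxx.
exists (fun h => if h == j then a |: B h else B h); split.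
- move=> h; have sB : B h \subset F by apply: subset_trans (BF h) (subD1set _ _).
  by case: eqP => // _; rewrite subUset sub1set aF.
- move=> h i hi; case: (eqVneq h j) => [hj|hj]; case: (eqVneq i j) => [ij|ij].
  + by rewrite hj ij eqxx in hi.
  + by rewrite disjoints_subset subUset sub1set inE aB -disjoints_subset Bd.
  + by rewrite disjoint_sym disjoints_subset subUset sub1set inE aB -disjoints_subset disjoint_sym Bd.
  + exact: Bd.
- move=> h; have [dep inc deg] := Bg h.
  have [hj|hj] := eqVneq h j; last by exists dep => // x; rewrite deg R'n.
  (* The old depths are raised by one to make room for [R j] at depth 0. No arc of [B j] ends in
     [R j], as those nodes have in-degree 0 there. *)
  subst h; exists (fun x => if x \in R j then 0%N else (dep x).+1).
    move=> b /setU1P[->|bB]; first by rewrite -/u -/v aR (negPf bR).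
    have bh : arc_head D b \notin R j.
      have := deg (arc_head D b); rewrite R'j inE negb_or; case: (_ \in R j); rewrite ?andbF //= => e.
      have : (0 < varrho D (B j) [set arc_head D b])%N; last by rewrite e.
        apply/card_gt0P; exists b; rewrite !inE bB eqxx andbT; 
        by apply/eqP=> eqt; have := inc b bB; rewrite eqt ltnn.
    by rewrite (negPf bh); case: ifP => // _; rewrite ltnS; apply: inc.
  have uv : u != v by apply: contraNneq bR => <-.
  move=> x; have [->|xv] := eqVneq x v.
    rewrite bR; have := deg v; rewrite R'j !inE eqxx /= => /eqP; rewrite cards_eq0 => /eqP e0.
    apply/eqP/cards1P; exists a; apply/setP=> b; have /setP/(_ b) := e0; rewrite !inE.
    by case: (eqVneq b a) => [-> _|_]; rewrite //= -/u -/v eqxx uv.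
  have := deg x; rewrite R'j !inE (negPf xv) /= => <-; apply: eq_card => b; rewrite !inE.
  case: (eqVneq b a) => [->|//]; rewrite -/v [v == x]eq_sym (negPf xv) !andbF //.
Qed.

End Branchings.

(** * Root sets of branchings *)

Section Roots.
Variables (V A : finType) (D : digraph V A).
Implicit Types (a : A) (B F : {set A}) (Y : {set V}).

Lemma forest_loopless B a : forest D B -> a \in B -> arc_tail D a != arc_head D a.
Proof.
move=> /(_ [:: (arc_head D a, a)]) fB aB; apply/negP=> /eqP e; case/negP: fB.
by rewrite /circuit /= aB /joins e eqxx.
Qed.

(* Otherwise following the arcs backwards never leaves Y and ends up in a circuit. *)
Lemma forest_entering B Y : forest D B -> Y != set0 ->
  (forall v, v \in Y -> (0 < varrho D B [set v])%N) -> (0 < varrho D B Y)%N.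
Proof.
move=> fB Y0 pos; rewrite lt0n; apply/negP=> /eqP vY0.
pose pre v := [pick a in entering D B [set v]].
have preP v : v \in Y -> exists2 a, pre v = Some a & [/\ a \in B, arc_head D a = v & arc_tail D a \in Y].
  move=> vY; rewrite /pre; case: pickP => [a|e0]; last first.
    by have /card_gt0P[a] := pos v vY; rewrite -/(entering _ _ _) e0.
  rewrite !inE => /and3P[aB _ /eqP ha]; exists a => //; split=> //.
  apply/negPn/negP=> tY; have /eqP := vY0; rewrite cards_eq0 => /eqP/setP/(_ a).
  by rewrite !inE aB tY ha vY.
pose f v := if pre v is Some a then arc_tail D a else v.
have PY : (Y != set0) && (f @: Y \subset Y).
  rewrite Y0; apply/subsetP=> _ /imsetP[v vY ->]; rewrite /f.
  by have [a -> [_ _ tY]] := preP v vY.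
have PY' : [&& Y != set0, Y \subset Y & f @: Y \subset Y] by case/andP: PY => -> ->; rewrite subxx.
(* On a minimal nonempty set closed under the predecessor map [f], the map is a permutation, and an
   orbit is a circuit. Extending it by the identity to [g] gives an injection of the whole type. *)
case: (@arg_minnP _ Y (fun Z : {set V} => [&& Z != set0, Z \subset Y & f @: Z \subset Z])
  (fun Z : {set V} => #|Z|) PY') => Z /and3P[Z0 ZY fZ] Zmin.
have fZc : #|f @: Z| = #|Z|.
  apply/eqP; rewrite eqn_leq leq_imset_card /=; apply: Zmin; apply/and3P; split.
  - by have /set0Pn[z zZ] := Z0; apply/set0Pn; exists (f z); apply: imset_f.
  - exact: subset_trans ZY.
  - exact: imsetS.
have injZ : {in Z &, injective f} by apply/imset_injP/eqP.
have fZi v : v \in Z -> f v \in Z by move=> vZ; apply: (subsetP fZ); apply: imset_f.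
pose g v := if v \in Z then f v else v.
have gZ v : v \in Z -> g v \in Z by move=> vZ; rewrite /g vZ fZi.
have injg : injective g.
  move=> x y; rewrite /g; case: ifP => xZ; case: ifP => yZ //; first exact: injZ.
    by move=> e; move: yZ; rewrite -e fZi.
  by move=> e; move: xZ; rewrite e fZi.
have /set0Pn[z zZ] := Z0.
have oZ : all [in Z] (orbit g z).
  apply/allP=> x; rewrite -fconnect_orbit => /iter_findex <-.
  by elim: (findex _ _ _) => //= m mZ; apply: gZ.
have /set0Pn[y0 y0Y] := Y0; have [a0 _ _] := preP y0 y0Y.
pose arc v := odflt a0 (pre v).
have arcP v : v \in Z -> [/\ arc v \in B, arc_head D (arc v) = v & arc_tail D (arc v) = g v].
  move=> vZ; have [a e [aB ha _]] := preP v (subsetP ZY v vZ).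
  by rewrite /arc /g /f vZ e.
have /negP := fB [seq (v, arc v) | v <- orbit g z]; apply; apply/and5P; split.
- by rewrite -size_eq0 size_map size_orbit -lt0n; apply: order_gt0.
- by rewrite -map_comp map_id_in ?orbit_uniq // => x.
- have : uniq [seq arc_head D x | x <- [seq x.2 | x <- [seq (v, arc v) | v <- orbit g z]]].
    rewrite -!map_comp map_id_in ?orbit_uniq // => x /(allP oZ) xZ /=.
    by have [_ -> _] := arcP x xZ.
  exact: map_uniq.
- by apply/allP=> _ /mapP[x /(allP oZ) xZ ->]; have [] := arcP x xZ.
- apply: (homo_cycle_in (e := frel g)) oZ (cycle_orbit injg z).
  move=> x y xZ _ /= /eqP <-; have [_ hx tx] := arcP x xZ.
  by rewrite /joins /= hx tx !eqxx orbT.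
Qed.

Definition root_set B : {set V} := [set v | varrho D B [set v] == 0%N].

Lemma branching_degree B v : branching D B -> varrho D B [set v] = (v \notin root_set B).
Proof. by case=> _ /(_ v); rewrite inE; case: (varrho _ _ _) => [|[]]. Qed.

(** Arcs are counted by their heads. A forest has no loops, so every arc enters its head, and each
    nonroot is entered exactly once. *)
Lemma card_branching B : branching D B -> #|B|%:Z = #|V|%:Z - #|root_set B|%:Z.
Proof.
move=> bB; have [fB _] := bB.
have E : #|B|%:Z = tilde (fun v => #|[set a in B | v \in [set arc_head D a]]|%:Z) setT.
  rewrite (double_count (fun a => [set arc_head D a])) -tilde1; apply: eq_bigr => a _.
  by rewrite setIT cards1.
rewrite E.
have -> : tilde (fun v => #|[set a in B | v \in [set arc_head D a]]|%:Z) setT =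
    tilde (fun v => (v \in ~: root_set B)%:Z) setT.
  apply: eq_bigr => v _; congr Posz; rewrite in_setC -branching_degree //; apply: eq_card => a.
  rewrite !inE [v == _]eq_sym; case aB: (a \in B) => //=.
  by have [<-|_] := eqVneq (arc_head D a) v; rewrite ?andbF // (forest_loopless fB aB).
by rewrite tilde_mem setIT; have := cardsC (root_set B); clear; lia.
Qed.

Section Family.
Variables (I : finType) (B : I -> {set A}).
Hypothesis disj : forall i j, i != j -> [disjoint B i & B j].

Lemma card_bigcup_disjoint (E : {set A}) :
  #|(\bigcup_j B j) :&: E|%:Z = tilde (fun j => #|B j :&: E|%:Z) setT.
Proof.
rewrite -double_count -tilde_mem; apply: eq_bigr => a _; congr Posz.
have [/bigcupP[j _ aj]|na] := boolP (a \in \bigcup_j B j).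
  symmetry; apply/eqP/cards1P; exists j; apply/setP=> i; rewrite !inE.
  apply/idP/eqP => [/= ai|->//]; apply/eqP; apply: contraT => /disj/disjoint_setI0/setP/(_ a).
  by rewrite !inE ai aj.
symmetry; apply/eqP; rewrite cards_eq0; apply/eqP/setP=> i; rewrite !inE.
by apply: contraNF na => ai; apply/bigcupP; exists i.
Qed.

Lemma varrho_bigcup Y :
  (varrho D (\bigcup_j B j) Y)%:Z = tilde (fun j => (varrho D (B j) Y)%:Z) setT.
Proof.
have E F : varrho D F Y = #|F :&: entering D setT Y|.
  by apply: eq_card => a; rewrite !inE.
by rewrite E card_bigcup_disjoint; apply: eq_bigr => j _; rewrite E.
Qed.

Hypothesis brB : forall j, branching D (B j).
Let R : {ffun I -> {set V}} := [ffun j => root_set (B j)].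

Lemma branchings_degree v :
  (varrho D (\bigcup_j B j) [set v])%:Z = #|I|%:Z - #|[set j | v \in R j]|%:Z.
Proof.
rewrite varrho_bigcup -cardsT -(cardsID [set j | v \in R j]) setTI PoszD addrC addKr.
rewrite setTD -[~: _]setIT -tilde_mem; apply: eq_bigr => j _; rewrite branching_degree //.
by rewrite !inE ffunE inE.
Qed.

Lemma branchings_size :
  #|\bigcup_j B j|%:Z = #|I|%:Z * #|V|%:Z - tilde (fun j => #|R j|%:Z) setT.
Proof.
rewrite -[\bigcup_j B j]setIT card_bigcup_disjoint -cardsT -tilde1 {2}/tilde mulr_suml tildeB.
apply: eq_bigr => j _; by rewrite setIT mul1r card_branching // ffunE.
Qed.

(** A branching without a root in [Y] has an arc entering [Y] by [forest_entering]; for different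
    branchings these arcs are distinct. *)
Lemma branchings_cover : covers (fun Y => #|I|%:Z - (varrho D setT Y)%:Z) R.
Proof.
apply/coversP=> Y Y0.
have le : (varrho D (\bigcup_j B j) Y <= varrho D setT Y)%N.
  by apply: subset_leq_card; apply/subsetP=> a; rewrite !inE => /andP[_ ->].
suff : #|~: hits R Y|%:Z <= (varrho D (\bigcup_j B j) Y)%:Z.
  by have := cardsC (hits R Y); move: le; clear; lia.
rewrite varrho_bigcup (tildeC _ (~: hits R Y)) -[X in X <= _]addr0; apply: lerD; last exact: sumr_ge0.
rewrite -tilde1; apply: ler_sum => j; rewrite in_setC => jh; rewrite lez_nat.
apply: forest_entering => // [|v vY]; first by case: (brB j).
rewrite lt0n; apply: contra jh => v0; apply/hitsP; exists v => //.
by rewrite ffunE inE.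
Qed.

End Family.
End Roots.

(** * Necessity of the inequalities *)

Section CutConditions.
Variables (I V : finType) (p : {set V} -> int) (R : {ffun I -> {set V}}).
Hypothesis cR : covers p R.

(** At most |X| of the rows hitting a member of [T] lie in [X]; each of the others has an entry in
    that member, and the members are disjoint. *)
Lemma covers_cut (X : {set I}) (W : {set V}) (T : {set {set V}}) : subpartition T W ->
  tilde p T - #|X|%:Z * #|T|%:Z <= tilde (fun h => #|R h :&: W|%:Z) (~: X).
Proof.
case/and3P=> tT n0 cW.
have -> : #|X|%:Z * #|T|%:Z = tilde (fun=> #|X|%:Z) T.
  by rewrite /tilde sumr_const -mulr_natr natz.
rewrite tildeB; apply: (@le_trans _ _ (tilde (fun B => tilde (fun h => #|R h :&: B|%:Z) (~: X)) T)).
  apply: ler_sum => B BT; have B0 : B != set0 by apply: contraNneq n0 => <-.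
  have := coversP _ _ cR B B0; have := cardsID X (hits R B).
  have := subset_leq_card (subsetIr (hits R B) X).
  have : #|hits R B :\: X|%:Z <= tilde (fun h => #|R h :&: B|%:Z) (~: X).
    rewrite setDE -tilde_mem; apply: ler_sum => h _; rewrite lez_nat inE -card_gt0.
    by case: #|_|.
  by clear; lia.
rewrite /tilde exchange_big; apply: ler_sum => h _ /=.
have -> : \sum_(B in T) #|R h :&: B|%:Z = #|R h :&: cover T|%:Z.
  by rewrite -tilde_mem /tilde big_trivIset //; apply: eq_bigr => B _; rewrite -tilde_mem.
by rewrite lez_nat; apply: subset_leq_card; apply: setIS.
Qed.

(** The entries are split into four blocks by [X] and [Y]. The block of [X] and [Y] has at most |X|
    |Y| entries, and the opposite block is bounded below by [covers_cut]. *)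
Lemma cut_conditions (fS gS : I -> int) (fT gT : V -> int) (alpha beta : int) :
    (forall j, fS j <= #|R j|%:Z <= gS j) ->
    (forall v, fT v <= #|[set j | v \in R j]|%:Z <= gT v) ->
    alpha <= tilde (fun j => #|R j|%:Z) setT <= beta ->
  forall (X : {set I}) (Y : {set V}) T, subpartition T (~: Y) ->
    [/\ tilde fT Y - #|X|%:Z * #|Y|%:Z + tilde p T - #|T|%:Z * #|X|%:Z <= tilde gS (~: X),
        tilde fS X - #|X|%:Z * #|Y|%:Z + tilde p T - #|T|%:Z * #|X|%:Z <= tilde gT (~: Y),
        alpha <= tilde gS (~: X) + tilde gT (~: Y) + #|X|%:Z * #|Y|%:Z
                   - (tilde p T - #|X|%:Z * #|T|%:Z)
      & tilde fS X + tilde fT Y - #|X|%:Z * #|Y|%:Z + tilde p T - #|X|%:Z * #|T|%:Z <= beta].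
Proof.
move=> bS bT /andP[al be] X Y T TY.
have K := covers_cut X TY.
pose e (X : {set I}) (W : {set V}) : int := tilde (fun h => #|R h :&: W|%:Z) X.
have eS Z : tilde (fun j => #|R j|%:Z) Z = e Z Y + e Z (~: Y).
  rewrite /e /tilde -big_split /=; apply: eq_bigr => j _.
  by rewrite -(cardsID Y (R j)) setDE PoszD.
have eT W : tilde (fun v => #|[set j | v \in R j]|%:Z) W = e X W + e (~: X) W.
  rewrite -(tildeC (fun h => #|R h :&: W|%:Z)) -double_count; apply: eq_bigr => v _.
  by congr Posz; apply: eq_card => j; rewrite !inE.
have eXY : e X Y <= #|X|%:Z * #|Y|%:Z.
  rewrite -tilde1 /tilde mulr_suml; apply: ler_sum => j _; rewrite mul1r lez_nat.
  exact: subset_leq_card (subsetIr _ _).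
have lS Z : tilde fS Z <= e Z Y + e Z (~: Y) by rewrite -eS; apply: le_tilde => j; case/andP: (bS j).
have uS Z : e Z Y + e Z (~: Y) <= tilde gS Z by rewrite -eS; apply: le_tilde => j; case/andP: (bS j).
have lT Z : tilde fT Z <= e X Z + e (~: X) Z by rewrite -eT; apply: le_tilde => j; case/andP: (bT j).
have uT Z : e X Z + e (~: X) Z <= tilde gT Z by rewrite -eT; apply: le_tilde => j; case/andP: (bT j).
have := lS X; have := uS (~: X); have := lT Y; have := uT (~: Y).
move: al be; rewrite (tildeC _ X) !eS => al be h1 h2 h3 h4.
rewrite -/(e _ _) in K; rewrite [#|T|%:Z * _]mulrC.
move: (e X Y) (e X (~: Y)) (e (~: X) Y) (e (~: X) (~: Y)) (#|X|%:Z * #|Y|%:Z) (#|X|%:Z * #|T|%:Z)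
   K eXY al be h1 h2 h3 h4; clear.
move=> a b c d xy xt K h al be h1 h2 h3 h4; split; lia.
Qed.
End CutConditions.

Unset Implicit Arguments.
Set Strict Implicit.
Set Printing Implicit Defensive.

Theorem theorem25 (V A : finType) (D : digraph V A) (k : nat) (k_gt0 : (0 < k)%N)
    (phi gamma : 'I_k -> int)
    (Hphi : forall j, 0 <= phi j /\ phi j <= gamma j /\ gamma j <= #|V|%:Z - 1)
    (f_in g_in : V -> int)
    (Hin : forall v, 0 <= f_in v /\ f_in v <= g_in v /\ g_in v <= k%:Z)
    (alpha_u beta_u : int) (Hu : alpha_u <= beta_u) :
  let n : int := #|V|%:Z in
  let f_S : 'I_k -> int := fun j => n - gamma j in
  let g_S : 'I_k -> int := fun j => n - phi j in
  let f_T : V -> int := fun v => k%:Z - g_in v in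
  let g_T : V -> int := fun v => k%:Z - f_in v in
  let alpha : int := k%:Z * n - beta_u in
  let beta : int := k%:Z * n - alpha_u in
  let p_T : {set V} -> int := fun Y =>
    if Y == set0 then 0 else k%:Z - (varrho D [set: A] Y)%:Z in
  (exists B : 'I_k -> {set A},
     let F := \bigcup_(j < k) B j in
     [/\ forall j, branching D (B j),
         forall i j, i != j -> [disjoint B i & B j],
         forall j, phi j <= #|B j|%:Z /\ #|B j|%:Z <= gamma j,
         forall v, f_in v <= (varrho D F [set v])%:Z /\
                   (varrho D F [set v])%:Z <= g_in v
       & alpha_u <= #|F|%:Z /\ #|F|%:Z <= beta_u])
  <->
  (forall (X : {set 'I_k}) (Y : {set V}) (T : {set {set V}}),
     subpartition T (~: Y) ->
     [/\ tilde f_T Y - #|X|%:Z * #|Y|%:Z + tilde p_T T - #|T|%:Z * #|X|%:Z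
           <= tilde g_S (~: X),
         tilde f_S X - #|X|%:Z * #|Y|%:Z + tilde p_T T - #|T|%:Z * #|X|%:Z
           <= tilde g_T (~: Y),
         alpha <= tilde g_S (~: X) + tilde g_T (~: Y) + #|X|%:Z * #|Y|%:Z
                    - (tilde p_T T - #|X|%:Z * #|T|%:Z)
       & tilde f_S X + tilde f_T Y - #|X|%:Z * #|Y|%:Z
           + tilde p_T T - #|X|%:Z * #|T|%:Z <= beta]).
Proof.
move=> n f_S g_S f_T g_T alpha beta p_T.
(* [p] may differ from [p_T] only at the empty set, which is never a member of a subpartition. *)
pose p (Y : {set V}) : int := #|'I_k|%:Z - (varrho D [set: A] Y)%:Z.
have p_super : intersecting_supermodular p by apply: deficiency_supermodular.
have pE T (W : {set V}) : subpartition T W -> tilde p_T T = tilde p T.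
  case/and3P=> _ T0 _; apply: eq_bigr => Y YT; rewrite /p_T /p card_ord.
  by case: eqP => // Y0; rewrite -Y0 YT in T0.
split=> [[B [brB disj szB degB totB]]|cond].
- pose R : {ffun 'I_k -> {set V}} := [ffun j => root_set D (B j)].
  have dR j : #|R j|%:Z = n - #|B j|%:Z.
    by rewrite ffunE (card_branching (brB j)) /n opprB addrC subrK.
  have cR : covers p R by apply: branchings_cover.
  have [bS bT bu] : [/\ forall j, f_S j <= #|R j|%:Z <= g_S j,
      forall v, f_T v <= #|[set j | v \in R j]|%:Z <= g_T v
    & alpha <= tilde (fun j => #|R j|%:Z) setT <= beta].
    split.
    + by move=> j; rewrite dR; have := szB j; rewrite /f_S /g_S; clear; lia.
    + move=> v; have := degB v; rewrite (branchings_degree disj brB) card_ord -/R /f_T /g_T.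
      by move: #|[set j | v \in R j]| => x; clear; lia.
    + have := totB; rewrite (branchings_size disj brB) card_ord -/R /alpha /beta -/n.
      by move: (tilde _ _) => x; move: (k%:Z * n) => y; clear; lia.
  move=> X Y T TY; rewrite (pE _ _ TY); exact: (cut_conditions cR).
have fgS j : f_S j <= g_S j by have := Hphi j; rewrite /f_S /g_S; clear; lia.
have fgT v : f_T v <= g_T v by have := Hin v; rewrite /f_T /g_T; clear; lia.
have ab : alpha <= beta by rewrite /alpha /beta; move: Hu; clear; lia.
have [|mS [mT [bS bT tot bu cut]]] := @degree_vectors _ _ p p_super f_S g_S f_T g_T alpha beta fgS fgT ab.
- move=> X W T TW; have := cond X (~: W) T; rewrite setCK => /(_ TW) [].
  rewrite (pE _ _ TW) /excess.
  move: (tilde f_T _) (tilde g_S _) (tilde f_S _) (tilde g_T _) (tilde p T) => a b c d e.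
  rewrite [#|T|%:Z * _]mulrC.
  move: (#|X|%:Z * #|~: W|%:Z) (#|X|%:Z * #|T|%:Z); clear => x y h1 h2 h3 h4; split; lia.
have mT0 v : 0 <= mT v <= k%:Z.
  by have := bT v; have := Hin v; rewrite /f_T /g_T; clear; lia.
have mTE v : mT v = (absz (mT v))%:Z by have := mT0 v; clear; lia.
have [R [cR dT dS]] : exists R : {ffun 'I_k -> {set V}},
    [/\ covers p R, forall v, #|[set j | v \in R j]| = absz (mT v) & forall j, #|R j|%:Z = mS j].
  apply: degree_specified => //.
  + by move=> v; rewrite card_ord; have := mT0 v; clear; lia.
  + by rewrite tot; apply: eq_bigr => v _; apply: mTE.
  + move=> X W T TW; apply: le_trans (cut X W T TW) _.
    by rewrite le_eqVlt; apply/orP; left; apply/eqP; apply: eq_bigr => v _; apply: mTE.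
have [B [_ disj grow]] := disjoint_growing cR.
have rB j : root_set D (B j) = R j.
  have [dep _ deg] := grow j; apply/setP=> v; rewrite inE deg; by case: (v \in R j).
have brB j : branching D (B j).
  have [dep inc deg] := grow j; apply: increasing_branching inc _ => v.
  by rewrite deg; case: (v \notin R j).
have RE : [ffun j => root_set D (B j)] = R by apply/ffunP=> j; rewrite ffunE rB.
have tS : tilde (fun j => #|R j|%:Z) setT = tilde mS setT by apply: eq_bigr => j _; apply: dS.
exists B; split=> //.
- move=> j; rewrite (card_branching (brB j)) rB dS; have := bS j; rewrite /f_S /g_S /n; clear; lia.
- move=> v; rewrite (branchings_degree disj brB) RE dT -mTE card_ord; have := bT v.
  by rewrite /f_T /g_T; clear; lia.
- rewrite (branchings_size disj brB) RE tS card_ord; move: bu; rewrite /alpha /beta /n; clear; lia.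
Qed.
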